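(* Let $p>3$ be a prime and $r\ge 1$ an integer. Then $$\sum_{k=0}^{p^r-1}(3k+1)\frac{(\frac12)_k^3}{(1)_k^3}4^k\equiv p^r+\frac76p^{r+3}B_{p-3}\pmod{p^{r+4}}.$$
   Context: $(x)_k=x(x+1)\cdots(x+k-1)$ is the Pochhammer symbol, with $(x)_0=1$. $B_0,B_1,B_2,\dots$ are the Bernoulli numbers. A congruence $a\equiv b\pmod{p^m}$ between rational numbers means that $(a-b)/p^m$ is a rational number whose denominator is not divisible by $p$. *)

(* Defs.v *)
From mathcomp Require Import all_boot all_order all_algebra.
Set Implicit Arguments. Unset Strict Implicit. Unset Printing Implicit Defensive.
Import Order.TTheory GRing.Theory Num.Theory.
Local Open Scope ring_scope.

Definition poch (x : rat) (k : nat) : rat := \prod_(i < k) (x + i%:R).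

(* bern_seq n = [:: B_0; B_1; ...; B_n], with the standard recursion
   B_0 = 1,  B_m = -1/(m+1) * sum_{k<m} C(m+1,k) B_k  (so B_1 = -1/2). *)
Fixpoint bern_seq (n : nat) : seq rat :=
  match n with
  | 0 => [:: 1]
  | n'.+1 => let s := bern_seq n' in
      rcons s (- (n'.+2)%:R^-1 * \sum_(k < n'.+1) ('C(n'.+2, k))%:R * s`_k)
  end.

Definition bernoulli (n : nat) : rat := (bern_seq n)`_n.

Definition rat_cong (p m : nat) (a b : rat) : Prop :=
  ~~ (p%:Z %| denq ((a - b) / (p%:R ^+ m)))%Z.

(* Main.v *)
Require Import Defs.
From mathcomp Require Import all_boot all_order all_algebra.
From mathcomp Require Import all_fingroup all_solvable all_field.
From mathcomp Require Import ring lra zify.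
Import Order.TTheory GRing.Theory Num.Theory.
Local Open Scope ring_scope.

(**
Put N = p^r = 2h+1. The rational functions
   F(n,x) = (3n+1) 4^n (1/2)_n (1/2+x)_n (1/2-x)_n / (n! (1+2x)_n (1-2x)_n 2x)
have a WZ mate G. Their residues at 2x = 2i form a WZ pair that vanishes for 2i > n,
so telescoping in i turns the sum over k < N into a sum of h+1 explicit products.
With a_l = N/(2l) and H the harmonic numbers this gives, modulo p^(r+4),
   N (1 - sum_(l <= h) (4 a_l^2 + 6 a_l^3 + 4 a_l^2 N (H_l - H_(2l)))).
Only the l divisible by p^(r-1) matter modulo p^4, so the second factor does not depend
on r.
For r = 1, reflecting k to p - k eliminates sum 1/l^2 in favour of p sum 1/l^3, and
there remain two sums in F_p, over 1/l^3 and (H_(2l) - H_l)/l^2. They are computed by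
interpolating H by a Bernoulli polynomial over F_p: sum_x x^(p-3) P(x) reads off a
coefficient of P, and the duplication formula for H evaluates the shifted sum.
*)

(** * The WZ pair *)

Lemma pochS x k : poch x k.+1 = poch x k * (x + k%:R).
Proof. by rewrite /poch big_ord_recr. Qed.

Lemma poch0 x : poch x 0 = 1.
Proof. by rewrite /poch big_ord0. Qed.

Lemma pochSl x k : poch x k.+1 = x * poch (x + 1) k.
Proof.
rewrite /poch big_ord_recl addr0; congr (_ * _).
by apply: eq_bigr => i _; rewrite lift0 -nat1r addrA.
Qed.

(* The convention 1/(negative)! = 0 makes the recurrence [inv_factS] unconditional. *)
Definition inv_fact (n m : nat) : rat :=
  if (m <= n)%N then (n - m)`!%:R^-1 else 0.

Lemma inv_factS n m : inv_fact n m.+1 = (n%:R - m%:R) * inv_fact n m.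
Proof.
rewrite /inv_fact; case: (ltngtP m n) => [lt_mn|lt_nm|->]; last by rewrite subrr mul0r.
  rewrite -natrB 1?ltnW // -[(n - m)%N]prednK ?subn_gt0 // factS natrM subnS.
  by rewrite invfM mulrA divff ?mul1r // pnatr_eq0.
by rewrite mulr0.
Qed.

Lemma inv_factSS n m : inv_fact n.+1 m.+1 = inv_fact n m.
Proof. by rewrite /inv_fact ltnS subSS. Qed.

Lemma inv_factS0 n : inv_fact n 0 = n.+1%:R * inv_fact n.+1 0.
Proof. by rewrite -(inv_factSS n) inv_factS subr0. Qed.

(** The central binomial coefficient (2n)!/n!^2, by [cbinE]; this form matches the summand of the
    theorem. *)
Definition cbin (n : nat) : rat := 4 ^+ n * poch (1 / 2) n / n`!%:R.

Lemma cbinS n : cbin n.+1 * n.+1%:R = cbin n * (4 * n%:R + 2).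
Proof.
rewrite /cbin pochS factS natrM invfM exprS.
have hn : n.+1%:R != 0 :> rat by rewrite pnatr_eq0.
have hf : n`!%:R != 0 :> rat by rewrite pnatr_eq0 -lt0n fact_gt0.
by field; rewrite hf addrC natr1.
Qed.

(* The residue of F(n,x) at 2x = 2i. *)
Definition wzF (n i : nat) : rat :=
  (3 * n%:R + 1) * cbin n * poch (1 / 2 + i%:R) n * poch (1 / 2 - i%:R) n
  * inv_fact n i.*2 * inv_fact (n + i.*2) 0.

(** The corresponding residue of the mate G. The factor [n%:R ^+ 2] makes it vanish at n = 0, where
    [n.-1] is truncated. *)
Definition wzG (n i : nat) : rat :=
  - 2 * n%:R ^+ 2 * cbin n * poch (1 / 2 + i%:R) n * poch (1 / 2 - i%:R) n.-1
  * inv_fact n i.*2.+1 * inv_fact (n + i.*2).+1 0.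

(** Once all shifted symbols are expressed through common factors, a polynomial identity remains. *)
Lemma wz_pair n i : wzF n i.+1 - wzF n i = wzG n.+1 i - wzG n i.
Proof.
have H1 : cbin n.+1 * n.+1%:R = cbin n * (4 * n%:R + 2) := cbinS n.
have i2 : i.*2%:R = 2 * i%:R :> rat by rewrite -mul2n natrM.
rewrite /wzF /wzG doubleS !addnS !addSn inv_factSS.
rewrite !(inv_factS n) (inv_factS0 (n + i.*2)) (inv_factS0 (n + i.*2).+1).
rewrite -(natr1 n) -(natr1 i) -!(natr1 (n + _).+1) -!(natr1 (n + _)) -!(natr1 i.*2) natrD i2.
set J := inv_fact n _; set K := inv_fact _ 0.
rewrite -[n.+1.-1]/n pochS -(natr1 n) in H1 *.
(* The case n = 0 is apart because of [n.-1]; there [J] vanishes unless i = 0. *)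
case: n H1 @J @K => [|n] H1 J K.
  rewrite /= !poch0 /K /J /inv_fact leqn0 double_eq0.
  move: H1 {i2}; case: eqP => [->|_] H1; last by ring.
  have -> : cbin 1 = 2 * cbin 0 by move: H1; rewrite mulr0n; lra.
  have -> : (0 + 0.*2).+2`!%:R = 2 :> rat by [].
  have -> : (0 + 0.*2)%:R = 0 :> rat by [].
  by rewrite /cbin poch0 fact0 /=; field.
rewrite -[n.+1.-1]/n.
(* Both sides are the symbol of length n + 2 starting at 1/2 + i. The factor 1/2 + i is kept to
   avoid a division; [E2] supplies it. *)
have E1 : poch (1 / 2 + (i%:R + 1)) n.+1 * (1 / 2 + i%:R)
          = poch (1 / 2 + i%:R) n.+1 * (1 / 2 + i%:R + n.+1%:R).
  by rewrite -pochS (pochSl _ n.+1) mulrC addrA.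
have E2 : poch (1 / 2 - (i%:R + 1)) n.+1 = - (1 / 2 + i%:R) * poch (1 / 2 - i%:R) n.
  rewrite pochSl; congr (_ * poch _ _); by field.
rewrite E2 [poch (1 / 2 - i%:R) n.+1]pochS.
set A := poch (1 / 2 + i%:R) n.+1 in E1 *.
set B := poch (1 / 2 - i%:R) n.
have -> : (3 * n.+1%:R + 1) * cbin n.+1 * poch (1 / 2 + (i%:R + 1)) n.+1
  * (- (1 / 2 + i%:R) * B) * ((n.+1%:R - (2 * i%:R + 1)) * ((n.+1%:R - 2 * i%:R) * J)) * K
  = (3 * n.+1%:R + 1) * cbin n.+1 * (- (A * (1 / 2 + i%:R + n.+1%:R)) * B)
   * ((n.+1%:R - (2 * i%:R + 1)) * ((n.+1%:R - 2 * i%:R) * J)) * K.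
  by rewrite -E1; ring.
have -> : -2 * (n.+1%:R + 1) ^+ 2 * cbin n.+2 = -2 * (n.+1%:R + 1) * (cbin n.+1 * (4 * n.+1%:R + 2)) :> rat.
  by rewrite -H1; ring.
by rewrite -(natr1 n); field.
Qed.

Lemma wzF_small n i : (n < i.*2)%N -> wzF n i = 0.
Proof. by move=> h; rewrite /wzF /inv_fact leqNgt h /= mulr0 mul0r. Qed.

(** Summing [wz_pair] over n < N telescopes to [wzG N i], since [wzG 0 i] is 0. Iterating over i
    moves the sum of [wzF] to i = h + 1, where 2i > n for every n < N and all terms vanish. *)
Lemma wz_sum N h : (N <= h.*2.+1)%N ->
  \sum_(n < N) wzF n 0 = - \sum_(i < h.+1) wzG N i.
Proof.
move=> le_N.
have step i : \sum_(n < N) wzF n i = \sum_(n < N) wzF n i.+1 - wzG N i.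
  have: \sum_(n < N) (wzF n i.+1 - wzF n i) = wzG N i.
    elim: N {le_N} => [|N IH]; first by rewrite big_ord0 /wzG !(mulr0, mul0r, expr0n).
    by rewrite big_ord_recr /= IH wz_pair addrC subrK.
  by rewrite sumrB => <-; ring.
have steps k : \sum_(n < N) wzF n 0 = \sum_(n < N) wzF n k - \sum_(i < k) wzG N i.
  elim: k => [|k ->]; first by rewrite big_ord0 subr0.
  by rewrite step big_ord_recr opprD addrA addrAC.
rewrite (steps h.+1) big1 ?sub0r // => n _; apply: wzF_small.
by apply: leq_trans (ltn_ord n) _; apply: leq_trans le_N _; rewrite doubleS.
Qed.

(** The quotient of consecutive terms, cross-multiplied so that it also holds where inverse
    factorials vanish. *)
Lemma wzGS N i :
  (1 / 2 + i%:R + N%:R) * ((N%:R - i.*2%:R - 1) * (N%:R - i.*2%:R - 2)) * wzG N i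
  = - (N%:R - 3 / 2 - i%:R) * ((N%:R + i.*2%:R + 2) * (N%:R + i.*2%:R + 3)) * wzG N i.+1.
Proof.
case: N => [|N]; first by rewrite /wzG expr0n !(mulr0, mul0r).
rewrite /wzG doubleS !addnS -[N.+1.-1]/N (inv_factS _ i.*2.+2) (inv_factS _ i.*2.+1) (inv_factS0 (_ + _).+1) (inv_factS0 (_ + _).+2).
set A := poch (1 / 2 + i%:R) _; set A' := poch (1 / 2 + i.+1%:R) _.
set B := poch (1 / 2 - i%:R) _; set B' := poch (1 / 2 - i.+1%:R) _.
set J := inv_fact _ i.*2.+1; set K := inv_fact _ 0.
have C0 : 1 / 2 + i%:R != 0 :> rat.
  by apply: lt0r_neq0; have : 0 <= i%:R :> rat by []; lra.
have EA : (1 / 2 + i%:R) * A' = A * (1 / 2 + i%:R + N.+1%:R).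
  by rewrite /A /A' -(natr1 i) addrA -pochSl pochS.
have EB : - (1 / 2 + i%:R) * B = B' * (N%:R - 1 / 2 - i%:R).
  transitivity (poch (1 / 2 - i.+1%:R) N.+1).
    by rewrite pochSl /B -(natr1 i); congr (_ * poch _ _); field.
  by rewrite pochS /B' -(natr1 i); congr (_ * _); field.
(* The extra nonzero factor 1/2 + i lets [EA] and [EB] apply without division. *)
apply: (mulfI C0).
have -> : (1 / 2 + i%:R) * ((1 / 2 + i%:R + N.+1%:R) * ((N.+1%:R - i.*2%:R - 1) * (N.+1%:R - i.*2%:R - 2)) *
  (-2 * N.+1%:R ^+ 2 * cbin N.+1 * A * B * J * ((N.+1 + i.*2).+2%:R * ((N.+1 + i.*2).+3%:R * K))))
  = (A * (1 / 2 + i%:R + N.+1%:R)) * (- (1 / 2 + i%:R) * B) * ((N.+1%:R - i.*2%:R - 1) * (N.+1%:R - i.*2%:R - 2)) *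
  (2 * N.+1%:R ^+ 2 * cbin N.+1 * J * ((N.+1 + i.*2).+2%:R * ((N.+1 + i.*2).+3%:R * K))) by ring.
rewrite -EA EB.
rewrite -!(natr1 (_ + _).+2) -!(natr1 (_ + _).+1) -!(natr1 (_ + _)) natrD -!(natr1 (i.*2).+1) -(natr1 i.*2) -(natr1 N).
by field.
Qed.

(** * Explicit products for the terms G(N, i) with N = 2h + 1 *)

Lemma cbinE n : cbin n = (n.*2)`!%:R / n`!%:R ^+ 2.
Proof.
elim: n => [|n IH]; first by rewrite /cbin poch0 fact0.
have hn : n%:R + 1 != 0 :> rat by rewrite natr1 pnatr_eq0.
have hf : n`!%:R != 0 :> rat by rewrite pnatr_eq0 -lt0n fact_gt0.
apply: (mulIf hn); rewrite natr1 cbinS IH doubleS !factS !natrM -!natr1 -mul2n natrM.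
by field; rewrite hn hf.
Qed.

Lemma poch_nat (x : rat) n : poch (x + 1) n = \prod_(1 <= k < n.+1) (x + k%:R).
Proof.
rewrite big_add1 big_mkord; apply: eq_bigr => i _.
by rewrite -nat1r addrA.
Qed.

Lemma natr_fact (R : pzSemiRingType) n : n`!%:R = \prod_(1 <= k < n.+1) k%:R :> R.
Proof. by rewrite fact_prod natr_prod. Qed.

Lemma big_fold (R : Type) (idx : R) (op : Monoid.com_law idx) (f : nat -> R) h :
  \big[op/idx]_(1 <= k < h.*2.+1) f k
  = \big[op/idx]_(1 <= m < h.+1) op (f m) (f (h.*2.+1 - m)%N).
Proof.
rewrite big_split /= (@big_cat_nat _ _ op h.+1) //=; last by rewrite ltnS -addnn leq_addr.
congr (op _ _); rewrite big_nat_rev /= -[X in \big[_/_]_(X <= _ < _) _]add1n big_addn.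
rewrite (_ : h.*2.+1 - h = h.+1)%N; last by rewrite -addnn; lia.
by apply: eq_big_nat => i hi; congr f; lia.
Qed.

(** The odd numbers below [h.*2.+1] are the reflections of the even ones. Against [big_fold] this
    gives a second evaluation of the sum of 1/k^2 over 0 < k < p. *)
Lemma big_even_odd (R : Type) (idx : R) (op : Monoid.com_law idx) (f : nat -> R) h :
  \big[op/idx]_(1 <= k < h.*2.+1) f k
  = \big[op/idx]_(1 <= m < h.+1) op (f m.*2) (f (h.*2.+1 - m.*2)%N).
Proof.
have: \big[op/idx]_(1 <= k < h.*2.+1) f k
  = \big[op/idx]_(1 <= m < h.+1) op (f m.*2) (f m.*2.-1).
  elim: h => [|h IH]; first by rewrite !big_geq.
  rewrite doubleS (@big_nat_recr _ _ _ h.*2.+2) // (@big_nat_recr _ _ _ h.*2.+1) // (@big_nat_recr _ _ _ h.+1) //= IH -Monoid.mulmA; congr (op _ _).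
  by rewrite Monoid.mulmC.
move=> ->; rewrite !big_split /=; congr (op _ _).
rewrite [RHS]big_nat_rev /=; apply: eq_big_nat => i hi; congr f; lia.
Qed.

(** Here 1/2 + h = N/2 and 1/2 - h = 1 - N/2, and (2N)! cancels against [cbin N]. With a = N/(2m)
    one has N - m = m(2a - 1), so pairing m with N - m leaves factors in a alone. *)
Lemma wzG_top h (N := h.*2.+1) :
  - wzG N h = N%:R * \prod_(1 <= m < h.+1)
    ((1 + N%:R / (2 * m%:R)) * (1 - 3 * (N%:R / (2 * m%:R))) * (1 - N%:R / (2 * m%:R)) ^+ 2
      / (1 - 2 * (N%:R / (2 * m%:R))) ^+ 2).
Proof.
have N0 : N%:R != 0 :> rat by rewrite pnatr_eq0.
have Nh : N%:R = 2 * h%:R + 1 :> rat by rewrite /N -natr1 -mul2n natrM.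
have P1 : poch (1 / 2 + h%:R) N = N%:R / 2 * \prod_(1 <= k < N) (N%:R / 2 + k%:R).
  by rewrite /N pochSl -poch_nat Nh; congr (_ * poch _ _); field.
have P2 : poch (1 / 2 - h%:R) N.-1 = \prod_(1 <= k < N) (- (N%:R / 2) + k%:R).
  by rewrite -poch_nat Nh; congr (poch _ _); field.
have J1 : inv_fact N h.*2.+1 = 1 by rewrite /inv_fact leqnn subnn.
have J2 : inv_fact (N + h.*2).+1 0 = ((N.*2)`!%:R)^-1.
  by rewrite /inv_fact leq0n subn0 -addnS -/N addnn.
have F : N`!%:R = N%:R * \prod_(1 <= k < N) k%:R :> rat.
  by rewrite /N factS natrM natr_fact.
set Q := \prod_(1 <= k < N) k%:R in F.
have Q0 : Q != 0 by rewrite -[Q]natr_fact pnatr_eq0 -lt0n fact_gt0.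
have f0 : (N.*2)`!%:R != 0 :> rat by rewrite pnatr_eq0 -lt0n fact_gt0.
have -> : - wzG N h = N%:R * ((\prod_(1 <= k < N) (N%:R / 2 + k%:R))
    * (\prod_(1 <= k < N) (- (N%:R / 2) + k%:R)) / Q ^+ 2).
  by rewrite /wzG P1 P2 J1 J2 cbinE F; field; rewrite N0 Q0 f0.
congr (_ * _); rewrite /Q !big_fold /= -/N -prodrXl -prodfV -!big_split /=.
rewrite big_nat [RHS]big_nat; apply: eq_bigr => m hm.
have m0 : m%:R != 0 :> rat by rewrite pnatr_eq0; lia.
have Nm : (N - m)%:R = N%:R - m%:R :> rat by rewrite natrB // /N; lia.
have Nm0 : N%:R - m%:R != 0 :> rat by rewrite -Nm pnatr_eq0 /N; lia.
rewrite Nm; field; rewrite m0 Nm0 /= andbT.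
by apply: contraNneq Nm0 => e; apply/eqP; lra.
Qed.

(** The non-trivial part of G(N, h - l)/G(N, h) at x = N. Every factor has the form 1 + c x/j, hence
    is 1 modulo p for x = N and the j that occur. *)
Definition Vfac (x : rat) (l : nat) : rat :=
  (\prod_(1 <= j < l.*2) (1 - 2 * (x / j%:R))) * (\prod_(1 <= j < l) (1 + x / j%:R / 2))
  / \prod_(1 <= j < l.+1) (1 - 3 * (x / j%:R / 2)).

Lemma VfacS x l : (0 < l)%N ->
  Vfac x l.+1 = Vfac x l * ((1 - 2 * (x / l.*2%:R)) * (1 - 2 * (x / l.*2.+1%:R))
    * (1 + x / l%:R / 2) / (1 - 3 * (x / l.+1%:R / 2))).
Proof.
move=> l0; rewrite /Vfac doubleS (@big_nat_recr _ _ _ l.*2.+1) //.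
rewrite (@big_nat_recr _ _ _ l.*2) ?double_gt0 // [X in _ * X / _](@big_nat_recr _ _ _ l) //.
rewrite (@big_nat_recr _ _ _ l.+1) //= invfM; ring.
Qed.

Lemma wzG_ratio h l (N := h.*2.+1) : (0 < l <= h)%N ->
  wzG N (h - l) = wzG N h * (- 2 * (N%:R / (2 * l%:R)) ^+ 2 * Vfac N%:R l).
Proof.
have Nh : N%:R = 2 * h%:R + 1 :> rat by rewrite /N -natr1 -mul2n natrM.
(* This is [wzGS] at i = h - k - 1, doubled to clear the halves. *)
have step k : (k < h)%N ->
  wzG N (h - k.+1) * (3 * N%:R - 2 * k%:R - 2) * ((2 * k%:R + 1) * (2 * k%:R + 2))
  = - (N%:R + 2 * k%:R) * ((2 * N%:R - 2 * k%:R) * (2 * N%:R - 2 * k%:R - 1)) * wzG N (h - k).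
  move=> hk; have := wzGS N (h - k.+1).
  rewrite -[(h - k.+1).+1]subSn // subSS -mul2n natrM natrB // -(natr1 k) Nh => e.
  transitivity (2 * ((1 / 2 + (h%:R - (k%:R + 1)) + (2 * h%:R + 1)) *
    ((2 * h%:R + 1 - 2 * (h%:R - (k%:R + 1)) - 1) *
     (2 * h%:R + 1 - 2 * (h%:R - (k%:R + 1)) - 2)) *
    wzG N (h - k.+1))); first by field.
  by rewrite e; field.
have pos k : (k < h)%N -> 3 * N%:R - 2 * k%:R - 2 != 0 :> rat.
  move=> hk; have : k%:R < h%:R :> rat by rewrite ltr_nat.
  by rewrite Nh => lt_kh; apply: lt0r_neq0; have : 0 <= k%:R :> rat by []; lra.
have p1 k : 2 * k%:R + 1 != 0 :> rat.
  by apply: lt0r_neq0; have : 0 <= k%:R :> rat by []; lra.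
have p2 k : k%:R + 1 != 0 :> rat.
  by apply: lt0r_neq0; have : 0 <= k%:R :> rat by []; lra.
elim: l => [//|l IH] hl.
have := step l hl; have := pos l hl.
(* At k = 0 the factors N + 2k and 2N - 2k become N and 2N, which produce the square of N/(2l); the
   pattern of [VfacS] starts only after that. *)
case: l IH hl => [|l] IH hl posl st.
  rewrite subn0 in st; rewrite /Vfac big_nat1 big_geq // big_nat1.
  apply: (mulIf posl); apply: (mulIf (p1 0)); apply: (mulIf (p2 0)).
  apply: (@mulIf _ 2) => //.
  transitivity (wzG N (h - 1) * (3 * N%:R - 2 * 0%:R - 2) *
     ((2 * 0%:R + 1) * (2 * 0%:R + 2))); first by ring.
  rewrite st; field. move: posl; rewrite mulr0n mulr0 subr0; lra.
have l0 := p2 l; rewrite natr1 in l0.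
set k := l.+1 in l0 IH st hl posl *.
have {}IH := IH (ltnW hl).
apply: (mulIf posl); apply: (mulIf (p1 k)); apply: (mulIf (p2 k)).
apply: (@mulIf _ 2) => //.
transitivity (wzG N (h - k.+1) * (3 * N%:R - 2 * k%:R - 2) *
     ((2 * k%:R + 1) * (2 * k%:R + 2))); first by ring.
rewrite st IH VfacS //.
rewrite -(natr1 k) -(natr1 k.*2) -mul2n natrM.
move: (p1 k) (p2 k) posl; rewrite -/k => q1 q2 q3.
field; rewrite q1 q2 l0 /= ?andbT.
by apply: contraNneq q3 => e; apply/eqP; lra.
Qed.

(** * Harmonic sums in F_p *)

(** Substituting g x for x, with g a generator of the unit group, multiplies the sum by g^e, which
    is not 1. *)
Lemma sum_expf_eq0 (F : finFieldType) e :
  ~~ (#|F|.-1 %| e)%N -> \sum_(x : F) x ^+ e = 0.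
Proof.
have [g Eg] := cyclicP (field_unit_group_cyclic [set: {unit F}]%G).
rewrite -card_finField_unit Eg -orderE order_dvdn => ge.
have ge1 : val g ^+ e != 1 by rewrite -FinRing.val_unitX; apply: contra ge => /eqP h; apply/eqP/val_inj.
have g0 : val g != 0 by rewrite -unitfE (valP g).
have : \sum_(x : F) x ^+ e = val g ^+ e * \sum_(x : F) x ^+ e.
  rewrite mulr_sumr (reindex_inj (mulfI g0)); apply: eq_bigr => x _.
  by rewrite exprMn.
move/eqP; rewrite -subr_eq0 -{1}[\sum_x _]mul1r -mulrBl mulf_eq0 subr_eq0 eq_sym.
by rewrite (negbTE ge1) => /eqP.
Qed.

Lemma expf_card_pred (F : finFieldType) (x : F) : x != 0 -> x ^+ #|F|.-1 = 1.
Proof.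
move=> x0; apply: (mulfI x0); rewrite mulr1 -exprS prednK ?expf_card //.
by apply/card_gt0P; exists x.
Qed.

Section Fp.
Variables (p : nat) (p_pr : prime p).

Lemma Fp_natp : p%:R = 0 :> 'F_p.
Proof. exact: pcharf0 (pchar_Fp p_pr). Qed.

Lemma Fp_natr_eq0 n : (n%:R == 0 :> 'F_p) = (p %| n)%N.
Proof. by rewrite (dvdn_pcharf (pchar_Fp p_pr)). Qed.

Lemma sum_expFp_pred : \sum_(x : 'F_p) x ^+ p.-1 = -1.
Proof.
have p1 := prime_gt1 p_pr.
rewrite (bigD1 0) //= expr0n -subn1 subn_eq0 leqNgt p1 add0r.
rewrite (eq_bigr (fun=> 1)) => [|x x0]; last first.
  by have := expf_card_pred _ _ x0; rewrite card_Fp // subn1.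
by rewrite sumr_const cardC1 card_Fp // -subn1 natrB ?(ltnW p1) // Fp_natp sub0r.
Qed.

Lemma sum_expFp e : (0 < e < (p.-1).*2)%N ->
  \sum_(x : 'F_p) x ^+ e = - (e == p.-1)%:R.
Proof.
case/andP=> e0 e2; have [->|ne] := eqVneq e p.-1; first exact: sum_expFp_pred.
rewrite oppr0; apply: sum_expf_eq0; rewrite card_Fp //.
apply: contra ne => /dvdnP [k Ek]; move: e0 e2.
by rewrite Ek; case: k {Ek} => [|[|k]] //; rewrite ?mul1n //; nia.
Qed.

(** By [sum_expFp] only the exponent k + i = p - 1 contributes; the bounds on k and on the size of
    [P] keep k + i strictly between 0 and 2(p - 1). *)
Lemma sum_expFp_horner (k : nat) (P : {poly 'F_p}) :
  (0 < k < p.-1)%N -> (size P <= p)%N ->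
  \sum_(x : 'F_p) x ^+ k * P.[x] = - P`_(p.-1 - k).
Proof.
move=> hk sP.
under eq_bigr => x _ do rewrite (horner_coef_wide _ sP) mulr_sumr.
rewrite exchange_big /=.
have hi : (p.-1 - k < p)%N by lia.
rewrite (bigD1 (Ordinal hi)) //= [X in _ + X]big1 => [|i ni].
  rewrite addr0; under eq_bigr => x _ do rewrite mulrCA -exprD.
  rewrite -mulr_sumr sum_expFp ?subnKC ?eqxx ?mulrN1 //; lia.
under eq_bigr => x _ do rewrite mulrCA -exprD.
rewrite -mulr_sumr sum_expFp; last by case: i {ni} => /= i; lia.
case: eqP => [e|_]; last by rewrite oppr0 mulr0.
case/negP: ni; apply/eqP/val_inj => /=; lia.
Qed.

(** It holds at x = 0 too, where both sides are 0 because 0^-1 = 0. Thus inverse powers are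
    polynomial functions and sums may run over the whole field. *)
Lemma expFp_inv (k : nat) (x : 'F_p) : (0 < k < p.-1)%N -> x ^+ (p.-1 - k) = x ^- k.
Proof.
case/andP=> k0 kp; have [->|x0] := eqVneq x 0.
  by rewrite !expr0n subn_eq0 leqNgt kp -[k == 0%N]negbK -lt0n k0 invr0.
apply: (mulIf (expf_neq0 k x0)); rewrite -exprD subnK ?(ltnW kp) // mulVf ?expf_neq0 //.
by have := expf_card_pred _ _ x0; rewrite card_Fp.
Qed.

Lemma Fp_nat_surj (x : 'F_p) : exists2 k : nat, (k < p)%N & x = k%:R.
Proof.
exists (x : nat); last by rewrite natr_Zp.
exact: leq_trans (ltn_ord x) (eq_leq (Fp_cast p_pr)).
Qed.

Lemma sum_Fp_nat (V : nmodType) (g : 'F_p -> V) :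
  \sum_(x : 'F_p) g x = \sum_(0 <= k < p) g k%:R.
Proof.
have e := Fp_cast p_pr.
rewrite big_mkord (reindex (fun i : 'I_p => (i : nat)%:R : 'F_p)) //=.
exists (fun x => cast_ord e x) => [i|x] _.
  apply: val_inj => /=.
  by rewrite val_Fp_nat // modn_small.
by apply: val_inj => /=; rewrite natr_Zp.
Qed.
End Fp.

(** * Bernoulli polynomials over a general ring *)

Lemma coef_XaddC_exp (R : comNzRingType) (c : R) n k :
  (('X + c%:P) ^+ n)`_k = c ^+ (n - k) *+ 'C(n, k).
Proof.
rewrite addrC exprDn coef_sum.
under eq_bigr => i _ do rewrite coefMn -polyC_exp coefCM coefXn.
have [kn|nk] := ltnP k n.+1.
  rewrite (bigD1 (Ordinal kn)) //= eqxx mulr1 big1 ?addr0 // => i ni.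
  by rewrite (_ : (k == i) = false) ?mulr0 ?mul0rn //; apply: contraNF ni => /eqP e; apply/eqP/val_inj.
rewrite bin_small // mulr0n big1 // => i _.
by rewrite (_ : (k == i) = false) ?mulr0 ?mul0rn //; apply/eqP; case: i => /= i; lia.
Qed.

(** The Bernoulli polynomial without its constant term [b n]: for n = p - 1 that term would be
    B_(p-1), which is not p-integral. *)
Definition bern_poly {R : nzRingType} (b : nat -> R) n : {poly R} :=
  \sum_(i < n) ('C(n, i)%:R * b i) *: 'X^(n - i).

(** Since C(n,i) C(n-i,j) = C(n,j) C(n-j,i), the coefficient of X^j is C(n,j) times the sum in the
    hypothesis for m = n - j. Subtracting the polynomial removes exactly the term i = n - j. *)
Lemma bern_polyS (R : comNzRingType) (b : nat -> R) n :
  (forall m, (0 < m <= n)%N -> \sum_(i < m) 'C(m, i)%:R * b i = (m == 1%N)%:R) ->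
  (0 < n)%N ->
  bern_poly b n \Po ('X + 1) - bern_poly b n = 'X^(n.-1) *+ n.
Proof.
move=> hb n0; apply/polyP => j.
rewrite /bern_poly rmorph_sum /= -sumrB coef_sum coefMn coefXn.
under eq_bigr => i _.
  rewrite comp_polyZ comp_Xn_poly -scalerBr coefZ coefB coefXn.
  rewrite -polyC1 coef_XaddC_exp expr1n.
  over.
have [jn|nj] := ltnP j n; last first.
  rewrite big1 => [|i _].
    by rewrite (_ : (j == n.-1) = false) ?mul0rn //; apply/eqP; lia.
  have [->|ne] := eqVneq j (n - i)%N; first by rewrite binn subrr mulr0.
  by rewrite (@bin_small (n - i)) ?subrr ?mulr0 //; move/eqP: ne; lia.
transitivity ('C(n, j)%:R * \sum_(i < n - j) 'C(n - j, i)%:R * b i); last first.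
  rewrite hb ?subn_gt0 ?jn ?leq_subr //.
  have [->|ne] := eqVneq j n.-1.
    by rewrite -subn1 bin_sub // subKn // bin1 mulr1.
  by rewrite (_ : (_ == 1%N) = false) ?mulr0 ?mul0rn //; apply/eqP; move/eqP: ne; lia.
rewrite (big_ord_widen n (fun i => 'C(n - j, i)%:R * b i)) ?leq_subr // mulr_sumr.
rewrite (bigID (fun i : 'I_n => i < n - j)%N) /= [X in _ + X]big1 ?addr0 => [|i].
  apply: eq_bigr => i hi; rewrite (_ : (j == n - i)%N = false) ?subr0; last by apply/eqP; lia.
  rewrite mulrAC mulrA -!natrM; congr (_%:R * _).
  have e1 := bin_fact (ltnW (ltn_ord i)); have e2 := bin_fact (ltnW jn).
  have e3 : ('C(n - i, j) * (j`! * (n - i - j)`!) = (n - i)`!)%N by apply: bin_fact; lia.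
  have e4 : ('C(n - j, i) * (i`! * (n - j - i)`!) = (n - j)`!)%N by apply: bin_fact; lia.
  apply/eqP; rewrite -(eqn_pmul2r (m := i`! * j`! * (n - i - j)`!)) ?muln_gt0 ?fact_gt0 //.
  apply/eqP; transitivity n`!.
    by rewrite -e1 -e3; ring.
  by rewrite -e2 -e4 subnAC; ring.
rewrite -leqNgt leq_eqVlt => /orP [/eqP e|lt].
  by rewrite (_ : n - i = j)%N ?binn ?eqxx ?subrr ?mulr0 //; case: i e => /= i; lia.
rewrite (_ : (j == n - i)%N = false) ?(@bin_small (n - i)) ?subrr ?mulr0 //; try (apply/eqP); case: i lt => /= i; lia.
Qed.

Lemma bern_poly_coef (R : nzRingType) (b : nat -> R) n k : (0 < k <= n)%N ->
  (bern_poly b n)`_k = 'C(n, k)%:R * b (n - k)%N.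
Proof.
case/andP=> k0 kn; rewrite coef_sum.
have hi : (n - k < n)%N by lia.
rewrite (bigD1 (Ordinal hi)) //= big1 ?addr0 => [|i ni].
  by rewrite coefZ coefXn subKn // eqxx mulr1 bin_sub.
rewrite coefZ coefXn (_ : _ == _ = false) ?mulr0 //.
apply: contraNF ni => /eqP e; apply/eqP/val_inj => /=; case: i e => /= i; lia.
Qed.

Lemma size_bern_poly (R : nzRingType) (b : nat -> R) n : (size (bern_poly b n) <= n.+1)%N.
Proof.
apply: (leq_trans (size_sum _ _ _)); apply/bigmax_leqP => i _.
by apply: (leq_trans (size_scale_leq _ _)); rewrite size_polyXn ltnS leq_subr.
Qed.

Lemma bern_poly0 (R : nzRingType) (b : nat -> R) n : (bern_poly b n).[0] = 0.
Proof.
rewrite horner_sum big1 // => i _; rewrite hornerZ hornerXn expr0n.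
by rewrite subn_eq0 leqNgt ltn_ord mulr0.
Qed.

Lemma inv_sqr_double (K : fieldType) (x : K) : 2 != 0 :> K -> 4 * (2 * x) ^- 2 = x ^- 2.
Proof.
move=> n2; have n4 : 4 != 0 :> K by rewrite (natrM _ 2 2) mulf_neq0.
rewrite exprMn invfM mulrA (_ : 2 ^+ 2 = 4) ?divff ?mul1r //.
by rewrite -natrX.
Qed.

(** * Harmonic numbers as a polynomial function on F_p *)

Section Harmonic.
Variables (p : nat) (p_pr : prime p) (p3 : (3 < p)%N) (b : nat -> 'F_p).
Hypothesis hb : forall m, (0 < m < p)%N -> \sum_(i < m) 'C(m, i)%:R * b i = (m == 1%N)%:R.

(** [P] interpolates the harmonic numbers: its value at n is H_(n-1), by [harm_nat]. The sign
    compensates p - 1 = -1. *)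
Let P := - bern_poly b p.-1.
Let f x := P.[x].
(** The second Taylor coefficient of [P] at x. *)
Let c2 (x : 'F_p) := (P \Po ('X + x%:P))`_2.

Let p4 : (4 < p)%N.
Proof. by rewrite ltn_neqAle p3 andbT; apply: contraL p_pr => /eqP <-. Qed.
Let p0 := Fp_natp _ p_pr.
Let n2 : 2 != 0 :> 'F_p.
Proof. by rewrite Fp_natr_eq0 // gtnNdvd //; lia. Qed.
Let n3 : 3 != 0 :> 'F_p.
Proof. by rewrite Fp_natr_eq0 // gtnNdvd //; lia. Qed.

Let n4 : 4 != 0 :> 'F_p.
Proof. by rewrite (natrM _ 2 2) mulf_neq0. Qed.
Let n6 : 6 != 0 :> 'F_p.
Proof. by rewrite (natrM _ 2 3) mulf_neq0. Qed.
Let n8 : 8 != 0 :> 'F_p.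
Proof. by rewrite (natrM _ 2 4) mulf_neq0. Qed.
Let n12 : 12 != 0 :> 'F_p.
Proof. by rewrite (natrM _ 2 6) mulf_neq0. Qed.

Let PS : P \Po ('X + 1) = P + 'X^(p - 2).
Proof.
have := bern_polyS _ b p.-1; rewrite -scaler_nat.
have -> : p.-1%:R = -1 :> 'F_p by rewrite -subn1 natrB ?prime_gt0 // p0 sub0r.
move=> h; rewrite /P rmorphN /= -[X in - X](subrK (bern_poly b p.-1)) h ?scaleN1r.
- by rewrite (_ : p.-1.-1 = p - 2)%N ?opprD ?opprK 1?addrC //; lia.
- by move=> m hm; apply: hb; lia.
by lia.
Qed.

Let sP : (size P <= p)%N.
Proof. by rewrite size_polyN (leq_trans (size_bern_poly _ _ _)) // prednK ?prime_gt0. Qed.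

Lemma harm0 : f 0 = 0.
Proof. by rewrite /f /P hornerN bern_poly0 oppr0. Qed.

Lemma harmS x : f (x + 1) = f x + x^-1.
Proof.
have := congr1 (horner^~ x) PS; rewrite horner_comp [(P + _).[_]]hornerD hornerXn (_ : ('X + 1).[x] = x + 1); last by rewrite !hornerE.
rewrite /f => ->.
by rewrite -[x^-1]expr1 exprVn -(expFp_inv _ p_pr) -?subn1 -?subnDA //; lia.
Qed.

Lemma harm_add (x : 'F_p) n : f (x + n%:R) = f x + \sum_(j < n) (x + j%:R)^-1.
Proof.
elim: n => [|n IH]; first by rewrite big_ord0 !addr0.
by rewrite -natr1 addrA harmS IH big_ord_recr /= addrA.
Qed.

Lemma harm_nat n : f n%:R = \sum_(j < n) (j%:R)^-1.
Proof.
by rewrite -[n%:R]add0r harm_add harm0 add0r; apply: eq_bigr => j _; rewrite add0r.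
Qed.

(** This is H_(p-1-k) = H_k. Both sides obey the same recurrence from 0, and every element of F_p is
    some k. *)
Lemma harm_opp x : f (- x) = f (x + 1).
Proof.
have [k _ ->] := Fp_nat_surj _ p_pr x; elim: k => [|k IH].
  by rewrite oppr0 harmS harm0 invr0 addr0.
rewrite -(natr1 k) [RHS]harmS; have := harmS (- (k%:R + 1)).
rewrite {1}opprD addrNK IH invrN => ->.
by rewrite addrNK.
Qed.

(** The analogue of the duplication formula of the digamma function: both sides vanish at 0 and have
    the same increments. *)
Lemma harm_double x : f (2 * x) = (f x + f (x + 2^-1) - f 2^-1) / 2.
Proof.
have [k _ ->] := Fp_nat_surj _ p_pr x; elim: k => [|k IH].
  by rewrite mulr0n mulr0 add0r harm0 add0r subrr mul0r.
have -> : 2 * k.+1%:R = 2 * k%:R + 1 + 1 :> 'F_p by rewrite -(natr1 k); ring.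
rewrite !harmS IH -(natr1 k) (addrAC _ 1) !harmS.
have -> : 2 * k%:R + 1 = 2 * (k%:R + 2^-1) :> 'F_p by field.
rewrite !invfM.
move: (k%:R^-1) ((k%:R + 2^-1)^-1) => u w.
by field.
Qed.

(** As x^-2 = x^(p-3), [sum_expFp_horner] extracts the coefficient of X^2 in P(X + c). *)
Lemma sum_harm_shift c : \sum_x x ^- 2 * f (x + c) = - c2 c.
Proof.
have e2 : (p.-1 - (p.-1 - 2) = 2)%N by lia.
rewrite /c2 -[in RHS]e2.
rewrite -sum_expFp_horner //; [|lia|]; last first.
  by rewrite size_comp_poly2 // size_XaddC.
apply: eq_bigr => x _; rewrite -expFp_inv //; last by lia.
by rewrite horner_comp hornerD hornerX hornerC.
Qed.

(** The coefficient of X^2 in (X + x)^(p-2) is C(p-2,2) x^(p-4), and C(p-2,2) = (-2)(-3)/2 = 3 in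
    F_p. *)
Lemma c2S x : c2 (x + 1) = c2 x + 3 * x ^- 3.
Proof.
have -> : c2 (x + 1) = ((P + 'X^(p - 2)) \Po ('X + x%:P))`_2.
  rewrite -PS -comp_polyA /c2; congr ((_ \Po _)`_2).
  by rewrite -polyC1 comp_polyD comp_polyX comp_polyC polyCD addrA.
rewrite comp_polyD coefD comp_Xn_poly coef_XaddC_exp.
have -> : (p - 2 - 2 = p.-1 - 3)%N by lia.
rewrite -mulr_natl; congr (_ + _ * _); last first.
  by rewrite expFp_inv //; lia.
apply: (mulfI n2); rewrite -natrM mul_bin_left bin1 natrM !natrB; try lia.
by rewrite p0; ring.
Qed.

Lemma c2_0 : c2 0 = - b (p - 3).
Proof.
rewrite /c2 polyC0 addr0 comp_polyXr coefN bern_poly_coef; last by lia.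
congr (- _); rewrite (_ : p.-1 - 2 = p - 3)%N; last by lia.
rewrite -[RHS]mul1r; congr (_ * _); apply: (mulfI n2).
rewrite -natrM mul_bin_left bin1 natrM -!subn1 -subnDA !natrB; try lia.
by rewrite p0; ring.
Qed.

Lemma sum_harm : \sum_x x ^- 2 * f x = b (p - 3).
Proof.
rewrite -[RHS]opprK -c2_0 -sum_harm_shift.
by apply: eq_bigr => x _; rewrite addr0.
Qed.

Variable q : nat.
Hypothesis pq : p = q.*2.+1.

Let half : 2^-1 = q.+1%:R :> 'F_p.
Proof.
apply: (mulfI n2); rewrite mulfV // -natrM mul2n doubleS -pq -natr1 p0 add0r //.
Qed.

(** The sum of x^-2 f(2x) is computed twice. The substitution 2x gives 4b with b = [b (p - 3)];
    [harm_double] gives (b - [c2] (1/2))/2. As 1/2 = q + 1, iterating [c2S] from 0 yields [c2] (1/2)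
    = -b + 3S, where S is the sum of cubes. Hence 8b = 2b - 3S. *)
Lemma sum_inv_cube : \sum_(1 <= l < q.+1) l%:R ^- 3 = - 2 * b (p - 3).
Proof.
have E1 : c2 2^-1 = c2 0 + 3 * \sum_(1 <= l < q.+1) l%:R ^- 3.
  have: forall n, c2 n%:R = c2 0 + 3 * \sum_(0 <= l < n) l%:R ^- 3.
    elim=> [|n IH]; first by rewrite big_geq // mulr0 addr0.
    by rewrite -natr1 c2S IH big_nat_recr //= mulrDr addrA.
  by rewrite half => ->; rewrite [in LHS]big_ltn // expr0n invr0 add0r.
have E2 : \sum_x x ^- 2 * f (2 * x) = 4 * \sum_x x ^- 2 * f x.
  rewrite [in RHS](reindex_inj (mulfI n2)) mulr_sumr /=; apply: eq_bigr => x _.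
  by rewrite mulrA inv_sqr_double.
have E3 : \sum_(x : 'F_p) x ^- 2 = 0.
  rewrite (eq_bigr (fun x => x ^+ (p.-1 - 2))) => [|x _]; last by rewrite expFp_inv //; lia.
  rewrite sum_expFp //; last by lia.
  by rewrite (_ : _ == _ = false) ?oppr0 //; apply/eqP; lia.
have E4 : \sum_x x ^- 2 * f (2 * x)
  = (\sum_x x ^- 2 * f x + \sum_x x ^- 2 * f (x + 2^-1) - f 2^-1 * \sum_(x : 'F_p) x ^- 2) / 2.
  rewrite mulr_sumr -big_split -sumrB mulr_suml /=; apply: eq_bigr => x _.
  by rewrite harm_double mulrA mulrBr mulrDr [f 2^-1 * _]mulrC.
move: E4; rewrite E2 E3 mulr0 subr0 sum_harm sum_harm_shift E1 c2_0.
set S := \sum_(1 <= _ < _) _ => E.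
apply: (mulfI n3); apply: (mulfI n2).
have -> : 2 * (3 * (-2 * b (p - 3))) = b (p - 3) *+ 2 - (b (p - 3) * 7) * 2 by ring.
have : 8 * b (p - 3) = b (p - 3) + (b (p - 3) - 3 * S).
  have -> : 8 * b (p - 3) = 2 * (4 * b (p - 3)) by ring.
  by rewrite E; field.
move=> e; have -> : 3 * S = b (p - 3) + b (p - 3) - 8 * b (p - 3) by rewrite e; ring.
by ring.
Qed.

Let g x := x ^- 2 * f x.

Let gN x : g (- x) = g x + x ^- 3.
Proof.
rewrite /g harm_opp harmS sqrrN mulrDr; congr (_ + _).
by rewrite -invfM -exprSr.
Qed.

Let sum_sym (h : 'F_p -> 'F_p) : h 0 = 0 ->
  \sum_x h x = \sum_(1 <= l < q.+1) (h l%:R + h (- l%:R)).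
Proof.
move=> h0; rewrite sum_Fp_nat // big_ltn ?prime_gt0 // h0 add0r [X in \big[_/_]_(1 <= _ < X) _]pq big_fold /=.
rewrite big_nat [RHS]big_nat; apply: eq_bigr => l hl.
by rewrite natrB -?pq ?p0 ?sub0r //; lia.
Qed.

(** Pairing x with -x turns full sums over F_p into sums over l <= q. This is applied to g(x) in [A]
    and to g(2x) in [B], which evaluates the two halves of the difference separately. *)
Lemma sum_harm_diff :
  \sum_(1 <= l < q.+1) l%:R ^- 2 * (\sum_(1 <= j < l.*2.+1) j%:R^-1 - \sum_(1 <= j < l.+1) j%:R^-1)
  = 3 / 2 * b (p - 3) - (\sum_(1 <= l < q.+1) l%:R ^- 3) / 4.
Proof.
have H n : \sum_(1 <= j < n.+1) j%:R^-1 = f (n%:R + 1).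
  by rewrite natr1 harm_nat -(big_mkord predT (fun j => (j%:R)^-1)) [in RHS]big_ltn // mulr0n invr0 add0r.
set S := \sum_(1 <= l < _) l%:R ^- 3.
have e8 : 2 ^+ 3 = 8 :> 'F_p by rewrite -natrX.
have g0 : g 0 = 0 by rewrite /g harm0 mulr0.
have A : b (p - 3) = 2 * (\sum_(1 <= l < q.+1) g l%:R) + S.
  rewrite -sum_harm (sum_sym g g0) mulr_sumr -big_split /=; apply: eq_bigr => l _.
  by rewrite gN; ring.
have B : b (p - 3) = 2 * (\sum_(1 <= l < q.+1) g (2 * l%:R)) + S / 8.
  rewrite -sum_harm (reindex_inj (mulfI n2)) (sum_sym (fun x => g (2 * x))) ?mulr0 //.
  rewrite mulr_sumr mulr_suml -big_split /=; apply: eq_bigr => l _.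
  by rewrite mulrN gN exprMn invfM e8 [_^-1 * _]mulrC addrA -mulr2n -(mulr_natl (g _)).
transitivity (\sum_(1 <= l < q.+1) (4 * g (2 * l%:R) + l%:R ^- 3 / 2 - g l%:R - l%:R ^- 3)).
  apply: eq_bigr => l _; rewrite !H harmS -mul2n natrM harmS /g mulrA inv_sqr_double //.
  rewrite [in RHS]exprSr !invfM -[in RHS]expr2; ring.
rewrite !sumrB big_split /= -mulr_sumr -mulr_suml -/S.
have -> : \sum_(1 <= l < q.+1) g l%:R = (b (p - 3) - S) / 2 by rewrite A; field.
have -> : \sum_(1 <= l < q.+1) g (2 * l%:R) = (b (p - 3) - S / 8) / 2 by rewrite {1}B; field; rewrite n2 n8.
by field; rewrite n2 ?n4 ?n8.
Qed.

(** The coefficient 5/12 is 7/6 - 3/4: the first part comes from eliminating the sum of 1/l^2, the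
    second from the cubic term of the expansion. *)
Lemma Fp_main :
  5 / 12 * \sum_(1 <= l < q.+1) l%:R ^- 3 +
  \sum_(1 <= l < q.+1) l%:R ^- 2 * (\sum_(1 <= j < l.*2.+1) j%:R^-1 - \sum_(1 <= j < l.+1) j%:R^-1)
  = 7 / 6 * b (p - 3).
Proof.
rewrite sum_harm_diff sum_inv_cube.
by field; rewrite ?n2 ?n4 ?n6 ?n12.
Qed.
End Harmonic.

(** * Congruences between p-integral rationals *)

(** Membership in the localization of Z at p. [pideal p m] is its ideal generated by p^m, so
    [rat_cong p m a b] unfolds to [pideal p m (a - b)]. *)
Definition plocal (p : nat) (x : rat) : bool := ~~ (p%:Z %| denq x)%Z.

Definition pideal (p m : nat) (x : rat) : bool := plocal p (x / p%:R ^+ m).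

(** The residue map to F_p, meaningful on [plocal] rationals; elsewhere the denominator reduces to 0
    and the value is 0. *)
Definition redp (p : nat) (x : rat) : 'F_p := (numq x)%:~R / (denq x)%:~R.

Section Local.
Variables (p : nat) (p_pr : prime p).

Lemma Fp_intr_eq0 (a : int) : (a%:~R == 0 :> 'F_p) = (p%:Z %| a)%Z.
Proof.
by rewrite dvdzE (dvdn_pcharf (pchar_Fp p_pr)); case: a => n //=; rewrite NegzE mulrNz oppr_eq0.
Qed.

Lemma frac_numden (a b : int) : b != 0 -> numq (a%:~R / b%:~R) * b = a * denq (a%:~R / b%:~R).
Proof.
move=> b0; apply: (@intr_inj rat); rewrite !intrM numqE mulrAC divfK //.
by rewrite intr_eq0.
Qed.

(** The reduced denominator divides [b]. *)
Lemma frac_ndvd (a b : int) : ~~ (p%:Z %| b)%Z -> plocal p (a%:~R / b%:~R).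
Proof.
move=> pb; have b0 : b != 0 by apply: contraNneq pb => ->; rewrite dvdz0.
have e := frac_numden a b b0; apply: contra pb => pd; apply: dvdz_trans pd _.
rewrite -(@Gauss_dvdzr _ (numq (a%:~R / b%:~R))) ?e ?dvdz_mull //.
by rewrite coprimezE coprime_sym coprime_num_den.
Qed.

(** Any representation with denominator prime to p computes [redp], so sums and products need no
    reduction to lowest terms. *)
Lemma redp_frac (a b : int) : ~~ (p%:Z %| b)%Z ->
  redp p (a%:~R / b%:~R) = a%:~R / b%:~R.
Proof.
move=> pb; have b0 : b != 0 by apply: contraNneq pb => ->; rewrite dvdz0.
have /(congr1 (fun z : int => z%:~R : 'F_p)) := frac_numden a b b0.
have := frac_ndvd a b pb; rewrite /plocal /redp -!Fp_intr_eq0 in pb *.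
move: (numq _) (denq _) => n d d0; rewrite !intrM => e.
by apply/eqP; rewrite eqr_div // e.
Qed.

Lemma plocalP x : reflect (exists a b : int, ~~ (p%:Z %| b)%Z /\ x = a%:~R / b%:~R) (plocal p x).
Proof.
apply: (iffP idP) => [lx|[a [b [pb ->]]]]; last exact: frac_ndvd.
by exists (numq x), (denq x); rewrite divq_num_den.
Qed.

Lemma ndvd_neq0 (b : int) : ~~ (p%:Z %| b)%Z -> (b%:~R != 0 :> rat).
Proof. by rewrite intr_eq0; apply: contraNneq => ->; rewrite dvdz0. Qed.

Lemma ndvdM (a b : int) : ~~ (p%:Z %| a)%Z -> ~~ (p%:Z %| b)%Z -> ~~ (p%:Z %| a * b)%Z.
Proof. by rewrite -!Fp_intr_eq0 intrM mulf_eq0 negb_or => -> ->. Qed.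

Lemma plocal_redpD x y : plocal p x -> plocal p y ->
  plocal p (x + y) /\ redp p (x + y) = redp p x + redp p y.
Proof.
move=> /plocalP [a [b [pb ->]]] /plocalP [c [d [pd ->]]].
have b0 := ndvd_neq0 _ pb; have d0 := ndvd_neq0 _ pd.
have -> : a%:~R / b%:~R + c%:~R / d%:~R = (a * d + c * b)%:~R / (b * d)%:~R :> rat.
  by rewrite intrD !intrM addf_div.
have pbd := ndvdM _ _ pb pd.
split; first exact: frac_ndvd.
rewrite !redp_frac //; rewrite -!Fp_intr_eq0 in pb pd.
by rewrite addf_div // intrD !intrM.
Qed.

Lemma plocal_redpM x y : plocal p x -> plocal p y ->
  plocal p (x * y) /\ redp p (x * y) = redp p x * redp p y.
Proof.
move=> /plocalP [a [b [pb ->]]] /plocalP [c [d [pd ->]]].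
have -> : a%:~R / b%:~R * (c%:~R / d%:~R) = (a * c)%:~R / (b * d)%:~R :> rat.
  by rewrite !intrM mulf_div.
have pbd := ndvdM _ _ pb pd.
split; first exact: frac_ndvd.
by rewrite !redp_frac // mulf_div !intrM.
Qed.

Lemma plocalD x y : plocal p x -> plocal p y -> plocal p (x + y).
Proof. by move=> lx ly; case: (plocal_redpD x y lx ly). Qed.

Lemma redpD x y : plocal p x -> plocal p y -> redp p (x + y) = redp p x + redp p y.
Proof. by move=> lx ly; case: (plocal_redpD x y lx ly). Qed.

Lemma plocalM x y : plocal p x -> plocal p y -> plocal p (x * y).
Proof. by move=> lx ly; case: (plocal_redpM x y lx ly). Qed.

Lemma redpM x y : plocal p x -> plocal p y -> redp p (x * y) = redp p x * redp p y.
Proof. by move=> lx ly; case: (plocal_redpM x y lx ly). Qed.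

Lemma ndvd1 : ~~ (p%:Z %| 1)%Z.
Proof. by rewrite dvdzE dvdn1 eqn_leq leqNgt prime_gt1. Qed.

Lemma plocal_int (a : int) : plocal p a%:~R.
Proof. by have := frac_ndvd a 1 ndvd1; rewrite divr1. Qed.

Lemma redp_int (a : int) : redp p a%:~R = a%:~R.
Proof. by have := redp_frac a 1 ndvd1; rewrite !divr1. Qed.

Lemma plocal_nat n : plocal p n%:R.
Proof. exact: plocal_int n%:Z. Qed.

Lemma redp_nat n : redp p n%:R = n%:R.
Proof. exact: redp_int n%:Z. Qed.

Lemma plocal_natV n : ~~ (p %| n)%N -> plocal p n%:R^-1.
Proof. by move=> pn; have := frac_ndvd 1 n pn; rewrite div1r. Qed.

Lemma redp_natV n : ~~ (p %| n)%N -> redp p n%:R^-1 = n%:R^-1.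
Proof. by move=> pn; have := redp_frac 1 n pn; rewrite !div1r. Qed.

Lemma plocalN x : plocal p x -> plocal p (- x).
Proof. by rewrite -mulN1r => lx; apply: plocalM lx; apply: (plocal_int (-1)). Qed.

Lemma redpN x : plocal p x -> redp p (- x) = - redp p x.
Proof.
move=> lx; have l1 : plocal p (-1) by exact: (plocal_int (-1)).
by rewrite -mulN1r redpM // (redp_int (-1)) mulN1r.
Qed.

Lemma plocalB x y : plocal p x -> plocal p y -> plocal p (x - y).
Proof. by move=> lx ly; apply: plocalD lx (plocalN _ ly). Qed.

Lemma redpB x y : plocal p x -> plocal p y -> redp p (x - y) = redp p x - redp p y.
Proof. by move=> lx ly; rewrite redpD ?redpN ?plocalN. Qed.

Lemma plocalX x n : plocal p x -> plocal p (x ^+ n).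
Proof.
move=> lx; elim: n => [|n IH]; first exact: (plocal_nat 1).
by rewrite exprS plocalM.
Qed.

Lemma redpX x n : plocal p x -> redp p (x ^+ n) = redp p x ^+ n.
Proof.
move=> lx; elim: n => [|n IH]; first by rewrite (redp_nat 1).
by rewrite !exprS redpM ?IH // plocalX.
Qed.

Lemma plocal_redp_sum (I : eqType) (s : seq I) (F : I -> rat) :
  (forall i, i \in s -> plocal p (F i)) ->
  plocal p (\sum_(i <- s) F i) /\ redp p (\sum_(i <- s) F i) = \sum_(i <- s) redp p (F i).
Proof.
elim: s => [|i s IH] h; first by rewrite !big_nil; split; [exact: plocal_nat 0|exact: redp_nat 0].
have [l1 r1] : plocal p (\sum_(i <- s) F i) /\ redp p (\sum_(i <- s) F i) = \sum_(i <- s) redp p (F i).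
  by apply: IH => j hj; apply: h; rewrite inE hj orbT.
have l2 : plocal p (F i) by apply: h; rewrite inE eqxx.
by rewrite !big_cons redpD // r1 plocalD.
Qed.

Lemma redp_eq0 x : plocal p x -> redp p x = 0 -> pideal p 1 x.
Proof.
move=> /plocalP [a [b [pb ->]]]; rewrite redp_frac // => /eqP.
rewrite mulf_eq0 invr_eq0 !Fp_intr_eq0 (negbTE pb) orbF => /dvdzP [c ->].
rewrite /pideal expr1 intrM mulrAC mulfK; first exact: frac_ndvd.
by rewrite intr_eq0 /=; case: p p_pr.
Qed.

(** With x = p a/b the inverse is b/(b + p a), whose denominator is prime to p. *)
Lemma plocal_inv1 x : pideal p 1 x -> plocal p (1 + x)^-1.
Proof.
have pr0 : p%:R != 0 :> rat by rewrite pnatr_eq0 -lt0n prime_gt0.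
rewrite /pideal expr1 => /plocalP [a [b [pb e]]].
have -> : x = (a * p%:Z)%:~R / b%:~R by rewrite intrM mulrAC -e mulfVK.
have b0 := ndvd_neq0 _ pb.
have -> : (1 + (a * p%:Z)%:~R / b%:~R)^-1 = b%:~R / (b + a * p%:Z)%:~R :> rat.
  by rewrite -{1}(divff b0) -mulrDl intrD invfM invrK mulrC.
apply: frac_ndvd; rewrite -Fp_intr_eq0 intrD intrM.
by rewrite [p%:Z%:~R](pcharf0 (pchar_Fp p_pr)) mulr0 addr0 Fp_intr_eq0.
Qed.

Lemma pideal0 x : pideal p 0 x = plocal p x.
Proof. by rewrite /pideal expr0 divr1. Qed.

Let ppr0 m : p%:R ^+ m != 0 :> rat.
Proof. by rewrite expf_neq0 // pnatr_eq0 -lt0n prime_gt0. Qed.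

Lemma pidealD m x y : pideal p m x -> pideal p m y -> pideal p m (x + y).
Proof. by rewrite /pideal mulrDl; apply: plocalD. Qed.

Lemma pidealN m x : pideal p m x -> pideal p m (- x).
Proof. by rewrite /pideal mulNr; apply: plocalN. Qed.

Lemma pidealB m x y : pideal p m x -> pideal p m y -> pideal p m (x - y).
Proof. by move=> hx hy; apply: pidealD hx (pidealN _ _ hy). Qed.

Lemma pidealM m n x y : pideal p m x -> pideal p n y -> pideal p (m + n) (x * y).
Proof. by rewrite /pideal exprD -mulf_div; apply: plocalM. Qed.

Lemma pidealMl m x y : plocal p x -> pideal p m y -> pideal p m (x * y).
Proof. by rewrite -(pideal0 x) => hx hy; exact: (pidealM 0 m). Qed.

Lemma pidealMr m x y : pideal p m x -> plocal p y -> pideal p m (x * y).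
Proof. by rewrite mulrC => hx hy; apply: pidealMl. Qed.

Lemma pidealX m n x : pideal p m x -> pideal p (n * m) (x ^+ n).
Proof. by rewrite /pideal mulnC exprM -expr_div_n; apply: plocalX. Qed.

Lemma pideal_exp m : pideal p m (p%:R ^+ m).
Proof. by rewrite /pideal divff //; exact: plocal_nat 1. Qed.

Lemma pidealW m n x : (m <= n)%N -> pideal p n x -> pideal p m x.
Proof.
move=> mn hx; rewrite /pideal.
have -> : x / p%:R ^+ m = x / p%:R ^+ n * p%:R ^+ (n - m).
  by apply: (mulIf (ppr0 m)); rewrite divfK // -(mulrA (x / _)) -exprD subnK // divfK.
by rewrite plocalM // plocalX // plocal_nat.
Qed.

Lemma pideal_local m x : pideal p m x -> plocal p x.
Proof. by rewrite -pideal0; apply: pidealW. Qed.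

Lemma pideal_sum (I : eqType) m (s : seq I) (F : I -> rat) :
  (forall i, i \in s -> pideal p m (F i)) -> pideal p m (\sum_(i <- s) F i).
Proof. by move=> h; rewrite /pideal mulr_suml; apply: (plocal_redp_sum _ _ _ h).1. Qed.

End Local.

(** * The case r = 1 *)

Lemma size_bern_seq n : size (bern_seq n) = n.+1.
Proof. by elim: n => //= n IH; rewrite size_rcons IH. Qed.

Lemma nth_bern_seq n k : (k <= n)%N -> (bern_seq n)`_k = bernoulli k.
Proof.
elim: n => [|n IH]; first by rewrite leqn0 => /eqP ->.
rewrite leq_eqVlt => /orP [/eqP -> //|kn].
by rewrite /= nth_rcons size_bern_seq kn IH.
Qed.

Lemma bernoulliS n :
  bernoulli n.+1 = - (n.+2)%:R^-1 * \sum_(k < n.+1) 'C(n.+2, k)%:R * bernoulli k.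
Proof.
rewrite /bernoulli /= nth_rcons size_bern_seq ltnn eqxx; congr (_ * _).
by apply: eq_bigr => k _; rewrite nth_bern_seq // -ltnS.
Qed.

Lemma bernoulli_sum m : (0 < m)%N -> \sum_(i < m) 'C(m, i)%:R * bernoulli i = (m == 1%N)%:R.
Proof.
case: m => [//|[|m]] _; first by rewrite big_ord1 bin0 mul1r.
have m0 : m.+2%:R != 0 :> rat by rewrite pnatr_eq0.
by rewrite big_ord_recr /= bernoulliS binSn mulrA mulrN divff // mulN1r subrr.
Qed.

Section Final.
Variables (p : nat) (p_pr : prime p) (p3 : (3 < p)%N).

Let p0 : p%:R != 0 :> rat.
Proof. by rewrite pnatr_eq0 -lt0n prime_gt0. Qed.

(** Up to B_n the recursion divides only by integers at most n + 1 < p. *)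
Lemma plocal_bernoulli n : (n.+1 < p)%N -> plocal p (bernoulli n).
Proof.
have [m] := ubnP n; elim: m n => [//|m IH] [_ _|n nm np]; first exact: (plocal_nat _ p_pr 1).
rewrite bernoulliS; apply: plocalM => //.
  by apply: plocalN => //; apply: plocal_natV => //; rewrite gtnNdvd.
apply: (plocal_redp_sum _ p_pr _ _ _ _).1 => i _.
by apply: plocalM => //; [exact: plocal_nat|apply: IH]; have := ltn_ord i; lia.
Qed.

(** This is the hypothesis [hb] of the computation in F_p. *)
Lemma redp_bernoulli_sum m : (0 < m < p)%N ->
  \sum_(i < m) 'C(m, i)%:R * redp p (bernoulli i) = (m == 1%N)%:R.
Proof.
case/andP=> m0 mp; rewrite -redp_nat // -bernoulli_sum //.
have lb (i : 'I_m) : plocal p (bernoulli i) by apply: plocal_bernoulli; have := ltn_ord i; lia.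
rewrite (plocal_redp_sum _ p_pr _ _ _ _).2 => [|i _]; last by apply: plocalM; rewrite ?plocal_nat.
by apply: eq_bigr => i _; rewrite redpM ?plocal_nat // redp_nat.
Qed.

Variable q : nat.
Hypothesis pq : p = q.*2.+1.

Let H n : rat := \sum_(1 <= j < n.+1) j%:R^-1.
Let S2 : rat := \sum_(1 <= l < q.+1) l%:R ^- 2.
Let S3 : rat := \sum_(1 <= l < q.+1) l%:R ^- 3.
Let W : rat := \sum_(1 <= l < q.+1) l%:R ^- 2 * (H l.*2 - H l).

Let ndvd n : (0 < n < p)%N -> ~~ (p %| n)%N.
Proof. by case/andP=> n0 np; rewrite gtnNdvd. Qed.

Let lV n : (0 < n < p)%N -> plocal p n%:R^-1.
Proof. by move=> hn; apply: plocal_natV => //; apply: ndvd. Qed.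

Let lVX n k : (0 < n < p)%N -> plocal p (n%:R ^- k).
Proof. by move=> hn; rewrite -exprVn; apply: plocalX => //; apply: lV. Qed.

Let redp_nat_sum (F : nat -> rat) (G : nat -> 'F_p) n :
  (forall l, (0 < l < n)%N -> plocal p (F l) /\ redp p (F l) = G l) ->
  plocal p (\sum_(1 <= l < n) F l) /\ redp p (\sum_(1 <= l < n) F l) = \sum_(1 <= l < n) G l.
Proof.
move=> h; have [|l r] := plocal_redp_sum _ p_pr _ (index_iota 1 n) F.
  by move=> i; rewrite mem_index_iota => hi; case: (h i hi).
split => //; rewrite r big_nat [RHS]big_nat; apply: eq_bigr => i hi; by case: (h i hi).
Qed.

Let redH n : (n < p)%N ->
  plocal p (H n) /\ redp p (H n) = \sum_(1 <= j < n.+1) j%:R^-1.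
Proof.
move=> np; apply: redp_nat_sum => l hl.
by rewrite redp_natV ?lV ?ndvd //; lia.
Qed.

Let redVX n k : (0 < n < p)%N -> redp p (n%:R ^- k) = n%:R ^- k.
Proof. by move=> hn; rewrite -!exprVn redpX ?redp_natV ?lV ?ndvd. Qed.

Let red3 : plocal p S3 /\ redp p S3 = \sum_(1 <= l < q.+1) l%:R ^- 3.
Proof.
apply: redp_nat_sum => l hl; have hl' : (0 < l < p)%N by lia.
by rewrite lVX ?redVX.
Qed.

Let redW : plocal p W /\ redp p W = \sum_(1 <= l < q.+1) l%:R ^- 2 *
   (\sum_(1 <= j < l.*2.+1) j%:R^-1 - \sum_(1 <= j < l.+1) j%:R^-1).
Proof.
apply: redp_nat_sum => l hl; have hl' : (0 < l < p)%N by lia.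
have [|l1 r1] := redH l; first by lia.
have [|l2 r2] := redH l.*2; first by lia.
have lB := plocalB _ p_pr _ _ l2 l1.
have lX := lVX l 2 hl'.
split; first exact: plocalM.
by rewrite redpM // redpB // r1 r2 redVX.
Qed.

Let n12 : ~~ (p %| 12)%N.
Proof.
have -> : 12%N = (2 * 2 * 3)%N by [].
by rewrite !Euclid_dvdM // !negb_or !gtnNdvd //; lia.
Qed.

Let n6 : ~~ (p %| 6)%N.
Proof.
have -> : 6%N = (2 * 3)%N by [].
by rewrite !Euclid_dvdM // !negb_or !gtnNdvd //; lia.
Qed.

Lemma harmonic_bernoulli : pideal p 1 (5 / 12 * S3 + W - 7 / 6 * bernoulli (p - 3)).
Proof.
have [l3 r3] := red3; have [lW rW] := redW.
have lb : plocal p (bernoulli (p - 3)) by apply: plocal_bernoulli; lia.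
have l12 : plocal p (5 / 12) by apply: plocalM; rewrite ?plocal_nat ?plocal_natV.
have l6 : plocal p (7 / 6) by apply: plocalM; rewrite ?plocal_nat ?plocal_natV.
have l123 := plocalM _ p_pr _ _ l12 l3.
have l6b := plocalM _ p_pr _ _ l6 lb.
have lsum := plocalD _ p_pr _ _ l123 lW.
apply: redp_eq0 => //; first exact: plocalB.
rewrite redpB // redpD // !redpM ?plocal_nat ?plocal_natV // !redp_nat // !redp_natV // r3 rW.
by rewrite (Fp_main p p_pr p3 (fun i => redp p (bernoulli i)) redp_bernoulli_sum q pq) subrr.
Qed.

(** The expansion of (p - m)^-2 to first order in p, with remainder p^2 (3m - 2p)/(m^3 (p -
    m)^2). *)
Let sqr_refl m : (0 < m < p)%N ->
  pideal p 2 ((p - m)%N%:R ^- 2 - m%:R ^- 2 - 2 * p%:R * m%:R ^- 3).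
Proof.
move=> hm.
have m0 : m%:R != 0 :> rat by rewrite pnatr_eq0; lia.
have hpm : (0 < p - m < p)%N by lia.
have pm0 : (p - m)%N%:R != 0 :> rat by rewrite pnatr_eq0; lia.
have -> : (p - m)%N%:R ^- 2 - m%:R ^- 2 - 2 * p%:R * m%:R ^- 3
  = p%:R ^+ 2 * ((3 * m%:R - 2 * p%:R) * (m%:R ^- 3 * (p - m)%N%:R ^- 2)) :> rat.
  have Epm : (p - m)%N%:R = p%:R - m%:R :> rat by rewrite natrB //; lia.
  by rewrite Epm in pm0 *; field; rewrite m0 pm0.
apply: pidealMr => //; first exact: pideal_exp.
by apply: plocalM => //; [apply: plocalB => //; apply: plocalM|apply: plocalM; rewrite ?lVX]; rewrite ?plocal_nat.
Qed.

(** Modulo p^2 the sum of 1/k^2 over 0 < k < p is 2 S2 + 2p S3 by reflection, and S2/2 + p S3/4 by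
    splitting into even k and reflected even k. The difference is 3/2 S2 + 7/4 p S3. *)
Lemma sum_sqr_cube : pideal p 2 (S2 + 7 / 6 * p%:R * S3).
Proof.
have E1 := big_fold _ _ +%R (fun k => k%:R ^- 2 : rat) q.
have E2 := big_even_odd _ _ +%R (fun k => k%:R ^- 2 : rat) q.
have I1 : pideal p 2 (\sum_(1 <= k < q.*2.+1) (k%:R ^- 2) - (2 * S2 + 2 * p%:R * S3)).
  rewrite E1 /S2 /S3 !mulr_sumr -big_split -sumrB /=.
  apply: pideal_sum => // m; rewrite mem_index_iota => hm; rewrite -pq.
  have := sqr_refl m; set A := (_ - m)%N%:R ^- 2.
  rewrite (_ : _ + A - _ = A - m%:R ^- 2 - 2 * p%:R * m%:R ^- 3); last by ring.
  by apply; lia.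
have I2 : pideal p 2 (\sum_(1 <= k < q.*2.+1) (k%:R ^- 2) - (S2 / 2 + p%:R * S3 / 4)).
  rewrite E2 /S2 /S3 !mulr_sumr !mulr_suml -big_split -sumrB /=.
  apply: pideal_sum => // m; rewrite mem_index_iota => hm; rewrite -pq.
  have := sqr_refl m.*2; set A := (_ - m.*2)%N%:R ^- 2.
  rewrite -mul2n natrM.
  have m0 : m%:R != 0 :> rat by rewrite pnatr_eq0; lia.
  rewrite (_ : _ + A - _ = A - (2 * m%:R) ^- 2 - 2 * p%:R * (2 * m%:R) ^- 3); last by field.
  by apply; lia.
have := pidealB _ p_pr _ _ _ I2 I1; set K := \sum_(1 <= _ < _) _.
rewrite (_ : _ - _ - _ = 3 / 2 * S2 + 7 / 4 * p%:R * S3); last by field.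
have l23 : plocal p (2 / 3).
  by apply: plocalM => //; rewrite ?plocal_nat ?plocal_natV // gtnNdvd.
move=> h; have := pidealMl _ p_pr _ _ _ l23 h.
by congr (pideal p 2 _); field.
Qed.

(** The sum equals -p^2 S2 - 3/4 p^3 S3 + p^3 W; trading S2 for S3 by [sum_sqr_cube] leaves p^3
    times the combination of [harmonic_bernoulli]. *)
Lemma prime_case_sum :
  pideal p 4 (\sum_(1 <= l < q.+1) (- 4 * (p%:R / (2 * l%:R)) ^+ 2 - 6 * (p%:R / (2 * l%:R)) ^+ 3
     - 4 * (p%:R / (2 * l%:R)) ^+ 2 * (p%:R * (H l - H l.*2))) - 7 / 6 * p%:R ^+ 3 * bernoulli (p - 3)).
Proof.
have -> : \sum_(1 <= l < q.+1) (- 4 * (p%:R / (2 * l%:R)) ^+ 2 - 6 * (p%:R / (2 * l%:R)) ^+ 3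
     - 4 * (p%:R / (2 * l%:R)) ^+ 2 * (p%:R * (H l - H l.*2)))
  = - p%:R ^+ 2 * S2 - 3 / 4 * p%:R ^+ 3 * S3 + p%:R ^+ 3 * W.
  rewrite /S2 /S3 /W !mulr_sumr -sumrB -big_split /=.
  rewrite big_nat [RHS]big_nat; apply: eq_bigr => m hm.
  have m0 : m%:R != 0 :> rat by rewrite pnatr_eq0; lia.
  by move: (H m) (H _) => u v; field.
rewrite (_ : _ - _ = p%:R ^+ 3 * (5 / 12 * S3 + W - 7 / 6 * bernoulli (p - 3))
   - p%:R ^+ 2 * (S2 + 7 / 6 * p%:R * S3)); last by field.
apply: pidealB => //.
  exact: (pidealM _ p_pr 3 1 _ _ (pideal_exp _ p_pr 3) harmonic_bernoulli).
exact: (pidealM _ p_pr 2 2 _ _ (pideal_exp _ p_pr 2) sum_sqr_cube).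
Qed.

End Final.

(** * Prime powers *)

Lemma poch1 k : poch 1 k = k`!%:R.
Proof. by rewrite -[1]add0r poch_nat natr_fact; apply: eq_bigr => i _; rewrite add0r. Qed.

Lemma summand_wzF (k : nat) :
  (3 * k + 1)%:R * (poch (1 / 2) k) ^+ 3 / (poch 1 k) ^+ 3 * 4 ^+ k = wzF k 0.
Proof.
have f0 : k`!%:R != 0 :> rat by rewrite pnatr_eq0 -lt0n fact_gt0.
rewrite /wzF /cbin /inv_fact poch1 mulr0n oppr0 !addr0 double0 addn0 leq0n subn0 natrD natrM.
by field.
Qed.

Section PowerSum.
Variables (p : nat) (p_pr : prime p).

(** Products of two or more [x j] lie in p^(2e). The first conclusion carries the induction for the
    second. *)
Lemma prod_one_plus e (s : seq nat) (x y : nat -> rat) :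
  (forall j, j \in s -> pideal p e (x j) /\ pideal p (e + e) (x j - y j)) ->
  pideal p e (\prod_(j <- s) (1 + x j) - 1) /\
  pideal p (e + e) (\prod_(j <- s) (1 + x j) - (1 + \sum_(j <- s) y j)).
Proof.
elim: s => [|j s IH] h.
  rewrite !big_nil addr0 subrr; split; rewrite /pideal mul0r; exact: (plocal_nat _ p_pr 0).
have [hx hxy] : pideal p e (x j) /\ pideal p (e + e) (x j - y j) by apply: h; rewrite inE eqxx.
have [P1 P2] := IH (fun i hi => h i (mem_behead (s := j :: s) hi)).
rewrite !big_cons; move: P1 P2; set P := \prod_(_ <- _) _; set S := \sum_(_ <- _) _ => P1 P2.
have hxP := pidealM _ p_pr _ _ _ _ hx P1.
split.
  rewrite (_ : _ - 1 = (P - 1) + x j + x j * (P - 1)); last by ring.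
  apply: pidealD => //; first exact: pidealD.
  by apply: pidealW hxP => //; exact: leq_addr.
rewrite (_ : _ - _ = (P - (1 + S)) + (x j - y j) + x j * (P - 1)); last by ring.
by do 2?apply: pidealD.
Qed.

Lemma sum_multiples (m d n : nat) (g : nat -> rat) : (0 < d)%N ->
  (forall j, (0 < j <= n)%N -> ~~ (d %| j)%N -> pideal p m (g j)) ->
  pideal p m (\sum_(1 <= j < n.+1) g j - \sum_(1 <= j < (n %/ d).+1) g (d * j)%N).
Proof.
move=> d0; elim: n => [|n IH] h.
  rewrite div0n !big_geq // subrr /pideal mul0r; exact: (plocal_nat _ p_pr 0).
have {}IH := IH (fun j hj => h j (introT andP (conj (proj1 (andP hj)) (leqW (proj2 (andP hj)))))).
rewrite divnS // big_nat_recr //=; have [dn|dn] := boolP (d %| n.+1)%N.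
  rewrite add1n [X in _ - X]big_nat_recr //=.
  have -> : (d * (n %/ d).+1 = n.+1)%N by rewrite -[RHS](divnK dn) divnS // dn add1n mulnC.
  by rewrite opprD addrACA subrr addr0.
by rewrite add0n addrAC; apply: pidealD => //; apply: h; rewrite ?ltnS ?leqnn.
Qed.

Variables (p3 : (3 < p)%N) (r q h : nat).
Hypotheses (r0 : (0 < r)%N) (pq : p = q.*2.+1) (Nh : (p ^ r = h.*2.+1)%N).

Let N : rat := (p ^ r)%N%:R.

Let p0 : p%:R != 0 :> rat.
Proof. by rewrite pnatr_eq0 -lt0n prime_gt0. Qed.

Lemma pideal_ratio m j : (0 < j)%N -> (logn p j + m <= r)%N -> pideal p m (N / j%:R).
Proof.
move=> j0; have [k cop Ej] := pfactor_coprime p_pr j0.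
move=> vm; rewrite Ej; move: (logn p j) vm => v vm.
have k0 : k%:R != 0 :> rat.
  by rewrite pnatr_eq0; apply: contraTneq cop => ->; rewrite /coprime gcdn0 neq_ltn prime_gt1 ?orbT.
have pk : ~~ (p %| k)%N by rewrite -prime_coprime.
rewrite /pideal /N natrM !natrX.
rewrite (_ : r = (r - (v + m)) + v + m)%N; last by lia.
rewrite !exprD (_ : _ / _ = p%:R ^+ (r - (v + m)) * k%:R^-1).
  by rewrite plocalM ?plocal_natV // plocalX // plocal_nat.
by field; rewrite k0 !expf_neq0.
Qed.

Let lognP j : (0 < j < p ^ r)%N -> (logn p j + 1 <= r)%N.
Proof.
case/andP=> j0 jN; rewrite addn1 -(ltn_exp2l _ _ (prime_gt1 p_pr)).
by apply: leq_ltn_trans jN; apply: dvdn_leq => //; apply: pfactor_dvdnn.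
Qed.

Let ratio1 j : (0 < j < p ^ r)%N -> pideal p 1 (N / j%:R).
Proof. by move=> hj; apply: pideal_ratio; [lia|exact: lognP]. Qed.

Let d := (p ^ r.-1)%N.

Let d0 : (0 < d)%N.
Proof. by rewrite expn_gt0 prime_gt0. Qed.

(** If p^(r-1) does not divide j, then j has valuation at most r - 2. *)
Let ratio2 j : (0 < j)%N -> ~~ (d %| j)%N -> pideal p 2 (N / j%:R).
Proof.
move=> j0; rewrite pfactor_dvdn // -ltnNge => hj; apply: pideal_ratio => //; lia.
Qed.

Let ratiod j : N / (d * j)%N%:R = p%:R / j%:R.
Proof.
rewrite /N -(prednK r0) expnS !natrM invfM mulrA -/d; congr (_ / _).
by rewrite mulfK // pnatr_eq0 -lt0n.
Qed.

(** Writing d = 2s + 1, the equation 2h + 1 = (2q + 1) d gives h = q d + s with s < d. *)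
Let hd : (h %/ d = q)%N.
Proof.
have E : (h.*2.+1 = q.*2.+1 * d)%N by rewrite -Nh -pq -(prednK r0) expnS.
have [s Es] : exists s, d = s.*2.+1.
  exists (d./2); rewrite -[LHS]odd_double_half.
  have : odd (h.*2.+1) by rewrite /= odd_double.
  by rewrite E oddM => /andP [_ ->].
have -> : h = (q * d + s)%N by move: E; rewrite Es -!mul2n; nia.
by rewrite divnMDl // divn_small ?addn0 // Es -addnn; lia.
Qed.

(** * Expansion of the h + 1 terms modulo p^4, with [K n] = N H_n and [a l] = N/(2l) *)

Let l2 : plocal p (1 / 2).
Proof. by rewrite div1r plocal_natV // gtnNdvd //; lia. Qed.

Let K n := \sum_(1 <= j < n.+1) N / j%:R.
Let a (l : nat) := N / (2 * l%:R).
Let ratio_double (l : nat) : N / l.*2%:R = a l.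
Proof. by rewrite -mul2n natrM. Qed.

Let a1 l : (0 < l <= h)%N -> pideal p 1 (a l).
Proof. by move=> hl; rewrite -ratio_double; apply: ratio1; rewrite Nh; lia. Qed.

Let K1 n : (n <= h.*2)%N -> pideal p 1 (K n).
Proof.
move=> hn; apply: pideal_sum => // j; rewrite mem_index_iota => hj.
by apply: ratio1; rewrite Nh; lia.
Qed.

Let lnat n : plocal p n%:R.
Proof. exact: plocal_nat. Qed.

(** Each factor is 1 - 2a^2 - 4a^3 + a^4 (16a - 11)/(1 - 2a)^2. Without a linear term it is 1 modulo
    p^2, so [prod_one_plus] with e = 2 gives the product modulo p^4. *)
Lemma top_factor_mod :
  pideal p 4 (\prod_(1 <= m < h.+1) ((1 + a m) * (1 - 3 * a m) * (1 - a m) ^+ 2 / (1 - 2 * a m) ^+ 2)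
   - (1 + \sum_(1 <= m < h.+1) (- 2 * a m ^+ 2 - 4 * a m ^+ 3))).
Proof.
rewrite (eq_bigr (fun m => 1 + ((1 + a m) * (1 - 3 * a m) * (1 - a m) ^+ 2 / (1 - 2 * a m) ^+ 2 - 1)));
  last by move=> m _; rewrite subrKC.
apply: (prod_one_plus 2 _ _ _ _).2 => m; rewrite mem_index_iota => hm.
have am : pideal p 1 (a m) by apply: a1; lia.
have am0 : 1 - 2 * a m != 0.
  have m0 : m%:R != 0 :> rat by rewrite pnatr_eq0; lia.
  have : m%:R - N != 0 by rewrite subr_eq0 /N eqr_nat Nh; apply/eqP; lia.
  apply: contraNneq => e; apply/eqP; transitivity (m%:R * (1 - 2 * a m)); last by rewrite e mulr0.
  by rewrite /a; field.
have lu : plocal p (1 - 2 * a m)^-1.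
  by apply: plocal_inv1 => //; apply: pidealN => //; apply: pidealMl.
have la := pideal_local _ p_pr _ _ am.
have E : (1 + a m) * (1 - 3 * a m) * (1 - a m) ^+ 2 / (1 - 2 * a m) ^+ 2 - 1
  - (- 2 * a m ^+ 2 - 4 * a m ^+ 3) = a m ^+ 4 * ((16 * a m - 11) * (1 - 2 * a m)^-1 ^+ 2).
  by field.
have h4 : pideal p 4 (a m ^+ 4 * ((16 * a m - 11) * (1 - 2 * a m)^-1 ^+ 2)).
  apply: pidealMr => //; first exact: (pidealX _ p_pr 1 4).
  by apply: plocalM => //; [apply: plocalB => //; apply: plocalM|apply: plocalX].
split; last by rewrite E.
rewrite -[X in pideal _ _ X](subrK (- 2 * a m ^+ 2 - 4 * a m ^+ 3)) E.
have am2 : pideal p 2 (a m ^+ 2) by exact: (pidealX _ p_pr 1 2).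
have am3 : pideal p 2 (a m ^+ 3) by apply: (pidealW _ p_pr 2 3) => //; exact: (pidealX _ p_pr 1 3).
apply: pidealD => //; first exact: (pidealW _ p_pr 2 4).
by apply: pidealB => //; apply: pidealMl => //; apply: plocalN.
Qed.

(** Precision p^2 is enough because [Vfac] is always multiplied by a square of [a l]. Each of the
    three products is linearized by [prod_one_plus] with e = 1. *)
Lemma Vfac_mod l : (0 < l <= h)%N ->
  pideal p 2 (Vfac N l - (1 + 2 * (K l - K l.*2) + a l)).
Proof.
move=> hl; have l0 : l%:R != 0 :> rat by rewrite pnatr_eq0; lia.
pose x1 (j : nat) := - (2 * (N / j%:R)); pose x2 (j : nat) := N / j%:R / 2.
pose x3 (j : nat) := - (3 * (N / j%:R / 2)).
have i1 j : j \in index_iota 1 l.*2 -> pideal p 1 (x1 j) /\ pideal p 2 (x1 j - x1 j).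
  rewrite mem_index_iota subrr /pideal mul0r => hj; split; last exact: (lnat 0).
  by apply: pidealN => //; apply: pidealMl => //; apply: ratio1; rewrite Nh; lia.
have i2 j : j \in index_iota 1 l -> pideal p 1 (x2 j) /\ pideal p 2 (x2 j - x2 j).
  rewrite mem_index_iota subrr {2}/pideal mul0r => hj; split; last exact: (lnat 0).
  by rewrite /x2 -[2^-1]div1r; apply: pidealMr => //; apply: ratio1; rewrite Nh; lia.
have i3 j : j \in index_iota 1 l.+1 -> pideal p 1 (x3 j) /\ pideal p 2 (x3 j - x3 j).
  rewrite mem_index_iota subrr {2}/pideal mul0r => hj; split; last exact: (lnat 0).
  apply: pidealN => //; apply: pidealMl => //; rewrite -[2^-1]div1r.
  by apply: pidealMr => //; apply: ratio1; rewrite Nh; lia.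
have [A1 A2] := prod_one_plus 1 _ _ _ i1.
have [B1 B2] := prod_one_plus 1 _ _ _ i2.
have [C1 C2] := prod_one_plus 1 _ _ _ i3.
have -> : Vfac N l = (\prod_(1 <= j < l.*2) (1 + x1 j)) * (\prod_(1 <= j < l) (1 + x2 j))
   / \prod_(1 <= j < l.+1) (1 + x3 j) by [].
move: A1 A2 B1 B2 C1 C2.
set A := \prod_(1 <= _ < l.*2) _; set B := \prod_(1 <= _ < l) _; set C := \prod_(1 <= _ < l.+1) _.
(* The range stops before 2l, so the last term N/(2l) = [a l] of [K l.*2] is taken off; likewise N/l
   = 2 [a l] below. *)
have -> : \sum_(1 <= j < l.*2) x1 j = - 2 * (K l.*2 - a l).
  rewrite /K big_nat_recr /= ?ratio_double ?addrK ?mulr_sumr; last by lia.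
  by apply: eq_bigr => j _; rewrite /x1 mulNr.
have -> : \sum_(1 <= j < l) x2 j = (K l - 2 * a l) / 2.
  rewrite /K big_nat_recr /=; last by lia.
  rewrite (_ : 2 * a l = N / l%:R) ?addrK ?mulr_suml //.
  by rewrite /a; field.
have -> : \sum_(1 <= j < l.+1) x3 j = - 3 * (K l / 2).
  by rewrite /K mulr_suml mulr_sumr; apply: eq_bigr => j _; rewrite /x3 mulNr.
have al : pideal p 1 (a l) by exact: a1.
have k1 : pideal p 1 (K l) by apply: K1; lia.
have k2 : pideal p 1 (K l.*2) by apply: K1; lia.
set al1 := -2 * (K l.*2 - a l); set al2 := (K l - 2 * a l) / 2; set al3 := -3 * (K l / 2).
have g1 : pideal p 1 al1 by apply: pidealMl => //; [exact: plocalN|exact: pidealB].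
have g2 : pideal p 1 al2.
  by rewrite /al2 -[2^-1]div1r; apply: pidealMr => //; apply: pidealB => //; apply: pidealMl.
have g3 : pideal p 1 al3.
  by apply: pidealMl => //; [exact: plocalN|rewrite -[2^-1]div1r; apply: pidealMr].
move=> A1 A2 B1 B2 C1 C2.
(* [C] is 1 modulo p; if it were 0, then 1/p would be p-integral. *)
have C0 : C != 0.
  apply: contraTneq C1 => ->; rewrite sub0r /pideal expr1 mulN1r.
  apply/negP => /(plocalN _ p_pr); rewrite opprK => hp.
  have := redpM _ p_pr _ _ (lnat p) hp; rewrite mulfV // (redp_nat _ p_pr 1) redp_nat //.
  by rewrite Fp_natp // mul0r => /eqP; rewrite oner_eq0.
have lC : plocal p C^-1 by rewrite -[C](subrKC 1); exact: plocal_inv1.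
have L x : pideal p 1 x -> plocal p (1 + x).
  by move=> hx; apply: plocalD => //; [exact: (lnat 1)|apply: pideal_local hx].
(* The error of the quotient is split so that each summand has a linearization error or a product of
   two elements of the ideal p. *)
rewrite (_ : _ - _ = C^-1 * ((A - (1 + al1)) * B + (1 + al1) * (B - (1 + al2)) + al1 * al2
    - (1 + al1 + al2 - al3) * (C - (1 + al3)) - (al1 + al2 - al3) * al3)); last first.
  rewrite /al1 /al2 /al3; field; exact: C0.
have lB : plocal p B by rewrite -[B](subrKC 1); exact: L.
have g12 : pideal p 1 (al1 + al2 - al3) by apply: pidealB => //; apply: pidealD.
apply: pidealMl => //.
apply: pidealB => //; last exact: (pidealM _ p_pr 1 1).
apply: pidealB => //; last first.
  by apply: pidealMl => //; rewrite -2!(addrA 1); exact: L.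
apply: pidealD => //; last exact: (pidealM _ p_pr 1 1).
apply: pidealD => //; first exact: pidealMr.
by apply: pidealMl => //; exact: L.
Qed.

Let V l := - 2 * a l ^+ 2 * Vfac N l.

(** Both the sum from [top_factor_mod] and the sum of [V] lie in p^2, so their product drops out and
    the two sums add. *)
Lemma quotient_mod :
  pideal p 4 ((\prod_(1 <= m < h.+1) ((1 + a m) * (1 - 3 * a m) * (1 - a m) ^+ 2 / (1 - 2 * a m) ^+ 2))
     * (1 + \sum_(1 <= l < h.+1) V l)
   - (1 + \sum_(1 <= l < h.+1)
       (- 4 * a l ^+ 2 - 6 * a l ^+ 3 - 4 * a l ^+ 2 * (K l - K l.*2)))).
Proof.
have T := top_factor_mod.
have a2 l : (0 < l <= h)%N -> pideal p 2 (- 2 * a l ^+ 2).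
  move=> hl; apply: pidealMl => //; first exact: plocalN.
  by apply: (pidealX _ p_pr 1 2) => //; exact: a1.
have V2 : pideal p 4 (\sum_(1 <= l < h.+1) V l
    - \sum_(1 <= l < h.+1) (- 2 * a l ^+ 2 * (1 + 2 * (K l - K l.*2) + a l))).
  rewrite -sumrB; apply: pideal_sum => // l; rewrite mem_index_iota => hl.
  rewrite /V -mulrBr; apply: (pidealM _ p_pr 2 2); first exact: a2.
  exact: Vfac_mod.
have V1 : pideal p 2 (\sum_(1 <= l < h.+1) V l).
  apply: pideal_sum => // l; rewrite mem_index_iota => hl.
  have la := pideal_local _ p_pr _ _ (a1 l hl).
  apply: pidealMr => //; first exact: a2.
  rewrite -[Vfac N l](subrK (1 + 2 * (K l - K l.*2) + a l)).
  apply: plocalD => //; first exact: pideal_local (Vfac_mod l hl).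
  apply: plocalD => //; apply: plocalD => //; first exact: (lnat 1).
  apply: plocalM => //; apply: plocalB => //; apply: (pideal_local _ p_pr 1); apply: K1; lia.
have Y2 : pideal p 2 (\sum_(1 <= m < h.+1) (- 2 * a m ^+ 2 - 4 * a m ^+ 3)).
  apply: pideal_sum => // l; rewrite mem_index_iota => hl.
  apply: pidealB => //; first exact: a2.
  apply: pidealMl => //; apply: (pidealW _ p_pr 2 3) => //.
  by apply: (pidealX _ p_pr 1 3) => //; exact: a1.
have -> : \sum_(1 <= l < h.+1) (- 4 * a l ^+ 2 - 6 * a l ^+ 3 - 4 * a l ^+ 2 * (K l - K l.*2))
  = \sum_(1 <= m < h.+1) (- 2 * a m ^+ 2 - 4 * a m ^+ 3)
    + \sum_(1 <= l < h.+1) (- 2 * a l ^+ 2 * (1 + 2 * (K l - K l.*2) + a l)).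
  by rewrite -big_split; apply: eq_bigr => l _ /=; ring.
move: T V2 V1 Y2; set P := \prod_(_ <= _ < _) _.
set Y := \sum_(_ <= _ < _) (_ - _); set E := \sum_(_ <= _ < _) V _.
set E' := \sum_(_ <= _ < _) _ => T V2 V1 Y2.
rewrite (_ : _ - _ = (P - (1 + Y)) + (E - E') + ((P - (1 + Y)) * E + Y * E)); last by ring.
apply: pidealD => //; first exact: pidealD.
apply: pidealD => //; last exact: (pidealM _ p_pr 2 2).
by apply: pidealMr => //; exact: pideal_local V1.
Qed.

Let L (x : nat) : rat := \sum_(1 <= j < x.+1) j%:R^-1.

Let sumd n : \sum_(1 <= j < n.+1) N / (d * j)%N%:R = p%:R * L n.
Proof. by rewrite /L mulr_sumr; apply: eq_bigr => j _; exact: ratiod. Qed.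

(** The j not divisible by d contribute N/j in p^2, and the multiples give p/j. *)
Let Kd l : pideal p 2 (K (d * l) - p%:R * L l).
Proof.
have := sum_multiples 2 d (d * l) (fun j => N / j%:R) d0 _.
rewrite mulKn // sumd.
by apply => j hj dj; apply: ratio2 => //; lia.
Qed.

(** If d does not divide l, then [a l] is in p^2 and the whole term in p^4. For multiples of d,
    [a (d * l)] is exactly p/(2l), and [K] is needed only modulo p^2. *)
Lemma sum_reduce :
  pideal p 4 (\sum_(1 <= l < h.+1)
       (- 4 * a l ^+ 2 - 6 * a l ^+ 3 - 4 * a l ^+ 2 * (K l - K l.*2))
   - \sum_(1 <= l < q.+1) (- 4 * (p%:R / (2 * l%:R)) ^+ 2 - 6 * (p%:R / (2 * l%:R)) ^+ 3
     - 4 * (p%:R / (2 * l%:R)) ^+ 2 * (p%:R * (L l - L l.*2)))).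
Proof.
set F := fun l => - 4 * a l ^+ 2 - 6 * a l ^+ 3 - 4 * a l ^+ 2 * (K l - K l.*2).
have := sum_multiples 4 d h F d0 _; rewrite hd => S1.
rewrite -[\sum_(1 <= l < h.+1) _](subrK (\sum_(1 <= l < q.+1) F (d * l)%N)) -addrA.
apply: pidealD => //.
  apply: S1 => l hl dl; have := ratio2 l (proj1 (andP hl)) dl => h2.
  have ha : pideal p 2 (a l).
    have -> : a l = 1 / 2 * (N / l%:R).
      have l0 : l%:R != 0 :> rat by rewrite pnatr_eq0; lia.
      by rewrite /a; field.
    exact: pidealMl.
  have a4 : pideal p 4 (a l ^+ 2) by exact: (pidealX _ p_pr 2 2).
  have lk : plocal p (K l - K l.*2).
    by apply: plocalB => //; apply: (pideal_local _ p_pr 1); apply: K1; lia.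
  apply: pidealB => //; last by apply: pidealMr => //; apply: pidealMl.
  apply: pidealB => //; first by apply: pidealMl => //; apply: plocalN.
  by apply: pidealMl => //; apply: (pidealW _ p_pr 4 6) => //; exact: (pidealX _ p_pr 2 3).
rewrite -sumrB; apply: pideal_sum => // l; rewrite mem_index_iota => hl.
have ad : a (d * l) = p%:R / (2 * l%:R).
  have half_div (y x : rat) : y / (2 * x) = y / x / 2 by rewrite invfM [2^-1 * _]mulrC mulrA.
  by rewrite /a !half_div ratiod.
have hl' : (0 < l <= q)%N by lia.
have k2 := Kd l.
have k2' : pideal p 2 (K (d * l).*2 - p%:R * L l.*2) by rewrite doubleMr; exact: Kd.
rewrite /F ad; set al := p%:R / _.
have ha : pideal p 1 al.
  rewrite /al -ad; apply: a1; rewrite muln_gt0 d0 (proj1 (andP hl')) /=.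
  by apply: leq_trans (leq_trunc_div h d); rewrite hd mulnC leq_mul2r (proj2 (andP hl')) orbT.
rewrite (_ : _ - _ = - 4 * (al ^+ 2 * ((K (d * l) - p%:R * L l) - (K (d * l).*2 - p%:R * L l.*2)))); last by ring.
apply: pidealMl => //; first exact: plocalN.
apply: (pidealM _ p_pr 2 2) => //; first exact: (pidealX _ p_pr 1 2).
exact: pidealB.
Qed.

(** The sum of [wzG] is read backwards from i = h and its top term factored out; the summand 1 is
    the case l = 0. *)
Lemma sum_wzF :
  \sum_(n < p ^ r) wzF n 0 = N
  * ((\prod_(1 <= m < h.+1) ((1 + a m) * (1 - 3 * a m) * (1 - a m) ^+ 2 / (1 - 2 * a m) ^+ 2))
     * (1 + \sum_(1 <= l < h.+1) V l)).
Proof.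
have le_N : (p ^ r <= h.*2.+1)%N by rewrite Nh.
rewrite (wz_sum _ h) // -(big_mkord predT (fun i => wzG (p ^ r) i)) big_nat_rev /=.
rewrite big_ltn // add0n subSS subn0.
rewrite big_nat (eq_bigr (fun l => wzG (p ^ r) h * V l)); last first.
  move=> l hl; rewrite subSS /V /a /N Nh wzG_ratio //; lia.
rewrite -big_nat -mulr_sumr -{1}[wzG _ h]mulr1 -mulrDr -mulNr.
by rewrite /a /N {1}Nh wzG_top -Nh mulrA.
Qed.

(** After [sum_reduce] the bracket modulo p^4 is the one of the case r = 1; the outer factor N = p^r
    raises the precision to p^(r+4). *)
Lemma power_sum_mod :
  rat_cong p (r + 4) (\sum_(n < p ^ r) wzF n 0)
    (p%:R ^+ r + 7 / 6 * p%:R ^+ (r + 3) * bernoulli (p - 3)).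
Proof.
rewrite /rat_cong -/(plocal p _) -/(pideal p (r + 4) _) sum_wzF.
have := quotient_mod; set U := _ * _ => hU.
have := pidealD _ p_pr _ _ _ hU (pidealD _ p_pr _ _ _ sum_reduce (prime_case_sum p p_pr p3 q pq)).
set Y := \sum_(1 <= l < h.+1) _; set Z := \sum_(1 <= l < q.+1) _.
rewrite (_ : U - _ + _ = U - 1 - 7 / 6 * p%:R ^+ 3 * bernoulli (p - 3)); last by ring.
move=> hh; have := pidealM _ p_pr _ _ _ _ (pideal_exp _ p_pr r) hh.
by congr (pideal p _ _); rewrite /N natrX exprD; ring.
Qed.

End PowerSum.

Theorem theorem1p1 (p r : nat) :
  prime p -> (3 < p)%N -> (1 <= r)%N ->
  rat_cong p (r + 4)
    (\sum_(k < p ^ r) (3 * k + 1)%:R * (poch (1 / 2) k) ^+ 3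
                        / (poch 1 k) ^+ 3 * 4 ^+ k)
    ((p%:R : rat) ^+ r + 7 / 6 * (p%:R : rat) ^+ (r + 3) * bernoulli (p - 3)).
Proof.
move=> p_pr p3 r0; rewrite (eq_bigr (fun k : 'I_(p ^ r) => wzF k 0)) => [|k _]; last exact: summand_wzF.
have podd : odd p by case/even_prime: (p_pr) => // p2; rewrite p2 in p3.
have half n : odd n -> n = n./2.*2.+1 by move=> on; rewrite -[LHS]odd_double_half on.
apply: (power_sum_mod p p_pr p3 r p./2 (p ^ r)./2) => //; apply: half => //.
by rewrite oddX podd orbT.
Qed.
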